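(* Let $\mathcal{T}:\mathbb{H}\to\mathbb{H}$ be a quasi-nonexpansive operator with $\operatorname{Fix}(\mathcal{T})\neq\emptyset$, and let $u:[t_0,+\infty)\to\mathbb{H}$ be a strong global solution of $$\frac{du}{dt}=\theta(t)\,[\mathcal{T}(u(t))-u(t)]+f(t),\qquad u(t_0)=u_0\in\mathbb{H}.$$ Then: (i) $\int_{t_0}^{+\infty}\theta(s)\|\mathcal{T}u(s)-u(s)\|^2\,ds<+\infty$. (ii) If $\mathcal{T}$ is uniformly continuous on $\mathbb{H}$ and $\inf_{t\in[t_0,+\infty)}\theta(t)>0$, then $\lim_{t\to+\infty}\|\mathcal{T}u(t)-u(t)\|=0$. (iii) If $\lim_{t\to+\infty}\|\mathcal{T}u(t)-u(t)\|=0$ and $\mathcal{T}$ satisfies the demiclosedness principle, then there exists $\hat u\in\operatorname{Fix}(\mathcal{T})$ such that $u(t)$ converges weakly to $\hat u$ as $t\to+\infty$.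
   Context: $\mathbb{H}$ is a real Hilbert space, $t_0>0$, $\theta:[t_0,+\infty)\to[0,+\infty)$ is locally integrable, and $f:[t_0,+\infty)\to\mathbb{H}$ belongs to $L^1([t_0,+\infty))$. $\operatorname{Fix}(\mathcal{T})=\{x:\mathcal{T}x=x\}$. $\mathcal{T}$ is quasi-nonexpansive if $\|\mathcal{T}y-x\|\le\|y-x\|$ for all $y\in\mathbb{H}$ and $x\in\operatorname{Fix}(\mathcal{T})$. $\mathcal{T}$ satisfies the demiclosedness principle if, for every sequence $(x_k)$ converging weakly to $x^*$ with $\|\mathcal{T}x_k-x_k\|\to0$, one has $\mathcal{T}x^*=x^*$. A strong global solution is a function $u:[t_0,+\infty)\to\mathbb{H}$ that is absolutely continuous on each interval $[t_0,b]$, $t_0<b<+\infty$, satisfies the differential equation for almost every $t\ge t_0$, and satisfies $u(t_0)=u_0$. *)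

(* Defs.v *)
From HB Require Import structures.
From mathcomp Require Import all_boot all_order all_algebra.
From mathcomp Require Import sesquilinear.
From mathcomp Require Import all_classical all_reals all_analysis.

Set Implicit Arguments.
Unset Strict Implicit.
Unset Printing Implicit Defensive.

Import Order.TTheory GRing.Theory Num.Theory.
Import numFieldNormedType.Exports.

Local Open Scope classical_set_scope.
Local Open Scope ring_scope.

(* A real Hilbert space is a complete normed module [H] together with a
   symmetric positive definite form [dot] that induces its norm. *)
Definition norm_from_dot (R : realType) (H : normedModType R)
    (dot : {dot H for idfun}) : Prop :=
  forall x : H, `|x| = Num.sqrt (dot x x).

Definition weak_cvg (R : realType) (H : normedModType R)
    (dot : {dot H for idfun}) (I : Type) (F : set_system I)
    (x_ : I -> H) (x : H) : Prop :=
  forall y : H, dot (x_ i) y @[i --> F] --> dot x y.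

Definition Fix (X : Type) (T : X -> X) : set X := [set x | T x = x].

Definition quasi_nonexpansive (R : realType) (H : normedModType R)
    (T : H -> H) : Prop :=
  forall y x : H, Fix T x -> `|T y - x| <= `|y - x|.

Definition demiclosedness_principle (R : realType) (H : normedModType R)
    (dot : {dot H for idfun}) (T : H -> H) : Prop :=
  forall (x_ : nat -> H) (x : H),
    weak_cvg dot \oo x_ x -> `|T (x_ k) - x_ k| @[k --> \oo] --> (0 : R) ->
    T x = x.

Section vector_valued_integrability.
Context d (X : measurableType d) (R : realType).
Variable mu : {measure set X -> \bar R}.
Variable H : normedModType R.

(* No Borel sigma-algebra on [H] is involved: in a nonseparable space Borel
   measurability would not be enough for Bochner integration. *)
Definition simple_function (s : X -> H) : Prop :=
  finite_set (range s) /\ forall y : H, measurable (s @^-1` [set y]).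

Definition strongly_measurable (D : set X) (f : X -> H) : Prop :=
  exists2 s : nat -> X -> H, forall n, simple_function (s n) &
    {ae mu, forall t, D t -> s n t @[n --> \oo] --> f t}.

Definition Bochner_integrable (D : set X) (f : X -> H) : Prop :=
  strongly_measurable D f /\ mu.-integrable D (fun t => `|f t|%:E).

End vector_valued_integrability.

(* [lebesgue_measure] is restricted to the Borel sets; the completed measure
   gives measurability and integrability in the sense of Lebesgue. *)
Notation lebesgue R := (@completed_lebesgue_measure R) (only parsing).

(* The library's [locally_integrable] requires [D] open, which excludes
   half-lines closed at their endpoint, and requires Borel measurability. *)
Definition locally_integrable_on (R : realType) (D : set R) (g : R -> R)
    : Prop :=
  forall K : set R, K `<=` D -> compact K ->
    (lebesgue R).-integrable K (fun t => (g t)%:E).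

Definition absolutely_continuous (R : realType) (H : normedModType R)
    (a b : R) (u : R -> H) : Prop :=
  forall e : R, 0 < e -> exists2 delta : R, 0 < delta &
    forall (n : nat) (l r : 'I_n -> R),
      (forall i, [/\ a <= l i, l i <= r i & r i <= b]) ->
      trivIset setT (fun i => [set` `]l i, r i[]) ->
      \sum_(i < n) (r i - l i) < delta ->
      \sum_(i < n) `|u (r i) - u (l i)| < e.

(* Functions on [[t0, +oo[] are represented by total functions on [R] whose
   values below [t0] are irrelevant; the two-sided derivative at the single
   point [t0] is immaterial as the equation is only required to hold almost
   everywhere. *)
Definition strong_global_solution (R : realType) (H : normedModType R)
    (t0 : R) (theta : R -> R) (f : R -> H) (T : H -> H) (u0 : H)
    (u : R -> H) : Prop :=
  [/\ forall b : R, t0 < b -> absolutely_continuous t0 b u,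
      {ae lebesgue R, forall t : R, t0 <= t ->
        is_derive t (1 : R) u (theta t *: (T (u t) - u t) + f t)} &
      u t0 = u0].

(* Main.v *)
(* For a fixed point [x], quasi-nonexpansiveness gives
   [d/dt |u - x|^2 <= - theta |T u - u|^2 + 2 |u - x| |f|] almost everywhere.
   Integrating this inequality bounds [|u - x|] and [\int theta |T u - u|^2], and
   shows that [|u t - x|] converges as [t --> +oo].

   For the second claim, wherever [|T u - u| >= e / 2] the speed
   [theta |T u - u| + |f|] is at most [(2 / e) theta |T u - u|^2 + |f|], which is
   integrable; so a late time [s] with [|T (u s) - u s| >= e] would keep [u] near
   [u s] for ever, and [theta |T u - u|^2] would not be integrable.

   For the third claim, weak limits of [u] along ultrafilters finer than [+oo] are
   also weak limits along sequences, hence fixed points by demiclosedness, and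
   Opial's argument shows that they all coincide. *)

Require Import Defs.
From HB Require Import structures.
From mathcomp Require Import all_boot all_order all_algebra.
From mathcomp Require Import sesquilinear.
From mathcomp Require Import all_classical all_reals all_analysis.
From mathcomp Require Import measurable_realfun.
From mathcomp Require Import ring lra.

Import Order.TTheory GRing.Theory Num.Theory.
Import numFieldNormedType.Exports.

Local Open Scope classical_set_scope.
Local Open Scope ring_scope.

(** * Monotonicity from an almost everywhere derivative *)

(** Nothing makes [T] or [T \o u] measurable, so the equation is never integrated in [H]. Every
    estimate says instead that a real-valued absolutely continuous function whose derivative is
    nonpositive almost everywhere does not increase; integrals enter through primitives [W] of
    [theta |T u - u|^2] and [A] of [|f|]. [W] exists before any global bound because [u] is bounded
    on each segment. The factor [|u - x|] in front of [|f|] is unknown at first: its maximum [M] on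
    a segment satisfies [M^2 <= |u t0 - x|^2 + 2 M A_oo], where [A_oo] is the integral of [|f|], and
    this bounds [M] independently of the segment. [H] may be nonseparable, which is why weak limits
    are taken along ultrafilters. *)

Section straddle.
Context {R : realType}.

(** The derivative at [c] controls [phi t - phi s] when [c] lies between [s] and [t]: the increments
    on either side of [c] are bounded separately and added. *)
Lemma straddle {phi : R -> R} {c d e : R} : is_derive c 1 phi d -> 0 < e ->
  exists2 rho, 0 < rho & forall s t, c - rho < s -> s <= c -> c <= t ->
    t < c + rho -> phi t - phi s <= (d + e) * (t - s).
Proof.
move=> dphi e0.
have : h^-1 *: (phi (h + c) - phi c) @[h --> 0^'] --> d.
  have [/cvg_ex[l] /=] := dphi.
  rewrite /derive => phil <-.
  have := cvg_lim (@Rhausdorff R) phil.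
  rewrite /= => ->; move: phil; apply: cvg_trans; apply: near_eq_cvg.
  by apply: nearW => h /=; rewrite [_ *: 1]mulr1.
move=> /cvgrPdist_le /(_ e e0) [rho /= rho0 H]; exists rho => // s t.
have {}H h : h != 0 -> `|h| < rho -> `|(phi (h + c) - phi c) - d * h| <= e * `|h|.
  move=> h0 hr; have := H h; rewrite /ball/= sub0r normrN => /(_ hr h0).
  rewrite distrC -(ler_pM2r (_ : 0 < `|h|)) ?normr_gt0// -normrM.
  by rewrite mulrBl mulrC [_ *: _]/(_ * _) mulrA mulfV// mul1r.
move=> cs sc ct tc.
have h1 : phi t - phi c <= (d + e) * (t - c).
  have [->|tc0] := eqVneq t c; first by rewrite !subrr mulr0.
  have := H (t - c); rewrite subr_eq0 subrK => /(_ tc0).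
  rewrite ger0_norm ?subr_ge0// => /(_ _)/ler_normlW; rewrite -lerBrDl.
  by move=> /(_ ltac:(lra)) ?; lra.
have h2 : phi c - phi s <= (d + e) * (c - s).
  have [->|tc0] := eqVneq s c; first by rewrite !subrr mulr0.
  have := H (s - c); rewrite subr_eq0 subrK => /(_ tc0).
  rewrite distrC ger0_norm ?subr_ge0// distrC => /(_ _).
  by rewrite ler_norml => /(_ ltac:(lra)) /andP[? ?]; lra.
by rewrite (_ : t - s = (t - c) + (c - s)) ?mulrDr; lra.
Qed.

End straddle.

Section interval_chains.
Context {R : realType}.
Notation mu := (@lebesgue_measure R).
Implicit Types (U : set R) (a t : R) (s : seq (R * R)).

(* Consecutive intervals are listed from right to left. *)
Fixpoint interval_chain U a t s : Prop :=
  if s is i :: s' then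
    [/\ i.1 <= i.2, i.2 <= t, `]i.1, i.2[ `<=` U & interval_chain U a i.1 s']
  else a <= t.

Lemma interval_chain_le U a t t' s : t <= t' ->
  interval_chain U a t s -> interval_chain U a t' s.
Proof.
by case: s => [/=|i s] tt'; [move=> /le_trans; exact|case=> ? it ? ?; split=> //;
  exact: le_trans tt'].
Qed.

Lemma interval_chain_ge U a t s : interval_chain U a t s -> a <= t.
Proof.
elim: s t => [//|i s ih] t [i12 it _ /ih ai].
by rewrite (le_trans ai)// (le_trans i12).
Qed.

Lemma interval_chain_bounds U a t s : interval_chain U a t s ->
  forall i, i \in s -> [/\ a <= i.1, i.1 <= i.2 & i.2 <= t].
Proof.
elim: s t => [//|i s ih] t [i12 it _ ais] j.
rewrite inE => /predU1P[->|js]; first by split => //; exact: interval_chain_ge ais.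
have [aj j12 ji] := ih _ ais _ js; split => //.
by rewrite (le_trans ji)// (le_trans i12).
Qed.

Lemma interval_chain_pairwise U a t s : interval_chain U a t s ->
  pairwise (fun i j : R * R => j.2 <= i.1) s.
Proof.
elim: s t => [//|i s ih] t [i12 it _ ais] /=; rewrite (ih _ ais) andbT.
by apply/allP => j js; have [] := interval_chain_bounds _ _ _ _ ais _ js.
Qed.

(** Measuring only the part of [U] left of [t] makes the induction close: the tail of the chain
    stays left of [i.1], disjoint from the first interval. *)
Lemma interval_chain_length U a t s : open U -> interval_chain U a t s ->
  ((\sum_(i <- s) (i.2 - i.1))%:E <= mu (U `&` `]-oo, t[))%E.
Proof.
move=> /open_measurable mU; elim: s t => [t _|i s ih t [i12 it iU /ih {}ih]].
  by rewrite big_nil measure_ge0.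
rewrite big_cons EFinD addeC.
have <- : mu `]i.1, i.2[ = (i.2 - i.1)%:E.
  rewrite lebesgue_measure_itv/= lte_fin; case: ltP => // i21.
  by rewrite (_ : i.2 = i.1) ?subrr//; apply/le_anti; rewrite i21.
apply: (@le_trans _ _ (mu (U `&` `]-oo, i.1[ `|` `]i.1, i.2[))).
  rewrite measureU//; first exact: leeD2r.
  - exact: measurableI.
  - rewrite -subset0 => x [[_] /=]; rewrite !in_itv/= => xi /andP[+ _].
    by rewrite ltNge (ltW xi).
apply: le_measure; rewrite ?inE.
- by apply: measurableU => //; exact: measurableI.
- exact: measurableI.
- move=> x /= [[Ux]|xi]; rewrite in_itv/=.
    move=> xi'.
    by split => //=; rewrite ?in_itv/= (lt_le_trans xi')// (le_trans i12).
  split; first exact: iU.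
  by move: xi => /=; rewrite !in_itv/= => /andP[_ /lt_le_trans]; exact.
Qed.

(** The premise is absolute continuity at one fixed pair [e], [d], since [U] is chosen only once [d]
    is known. *)
Lemma interval_chain_increments {H : normedModType R} {u : R -> H} {a b d e : R} :
  (forall (n : nat) (l r : 'I_n -> R),
      (forall i, [/\ a <= l i, l i <= r i & r i <= b]) ->
      trivIset setT (fun i => [set` `]l i, r i[]) ->
      \sum_(i < n) (r i - l i) < d ->
      \sum_(i < n) `|u (r i) - u (l i)| < e) ->
  forall U s, open U -> (mu U < d%:E)%E -> interval_chain U a b s ->
  \sum_(i <- s) `|u i.2 - u i.1| < e.
Proof.
move=> uac U s oU Ud sch; rewrite (big_nth (0, 0)) big_mkord.
apply: uac => [i|i j _ _|].
- exact: (interval_chain_bounds _ _ _ _ sch (nth (0, 0) s i) (mem_nth _ (ltn_ord i))).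
- have /(pairwiseP (0, 0)) pw := interval_chain_pairwise _ _ _ _ sch.
  have disj (p q : 'I_(size s)) : (p < q)%N ->
      ([set` `](nth (0, 0) s p).1, (nth (0, 0) s p).2[] `&`
       [set` `](nth (0, 0) s q).1, (nth (0, 0) s q).2[]) !=set0 -> False.
    move=> pq [x [/=]]; rewrite !in_itv/= => /andP[px _] /andP[_ xq].
    have := pw p q (ltn_ord p) (ltn_ord q) pq.
    by rewrite leNgt (lt_trans px xq).
  have [ij|ji|/val_inj//] := ltngtP i j.
  - by move=> /(disj _ _ ij).
  - by rewrite setIC => /(disj _ _ ji).
- rewrite -lte_fin; apply: le_lt_trans Ud.
  have := interval_chain_length _ _ _ _ oU sch.
  rewrite (big_nth (0, 0)) big_mkord => /le_trans; apply.
  apply: le_measure; rewrite ?inE//.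
  + by apply: measurableI => //; exact: open_measurable.
  + exact: open_measurable.
Qed.

End interval_chains.

Section absolute_continuity.
Context {R : realType}.
Notation mu := (@lebesgue_measure R).
Notation lambda := (@completed_lebesgue_measure R).

Lemma negligible_open_cover {N : set R} {e : R} : lambda.-negligible N -> 0 < e ->
  exists U, [/\ open U, N `<=` U & (mu U < e%:E)%E].
Proof.
move=> [A [mA A0 NA]] e0.
have [U [oU AU Ue]] := outer_measure_open_le A (divr_gt0 e0 (ltr0n R 2)).
exists U; split => //; first exact: subset_trans AU.
apply: le_lt_trans Ue _; rewrite [X in (X + _)%E]A0 add0e lte_fin; lra.
Qed.

(* Every point has a neighbourhood in which an interval around it either obeys
   the slope bound or lies in a small open set covering the exceptional null
   set; a supremum argument chains such intervals from [a] to [b]. *)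
Lemma absolutely_continuous_nonincreasing {phi : R -> R} {a b : R} : a <= b ->
  absolutely_continuous a b phi ->
  {ae lambda, forall t : R, a < t -> t < b -> exists2 d, is_derive t 1 phi d & d <= 0} ->
  phi b <= phi a.
Proof.
move=> ab phiac phid; apply/ler_addgt0Pr => e e0.
(* Slope [e'] over [[a, b]] costs at most [e / 2]; the other half pays for the variation of [phi] on
   [U]. The [+ 1] allows [a = b]. *)
pose e' := e / 2 / (b - a + 1).
have e'0 : 0 < e' by rewrite !divr_gt0//; lra.
have [d d0 phi_d] := phiac _ (divr_gt0 e0 (ltr0n R 2)).
(* The endpoints join the exceptional set because the hypothesis gives no derivative there. *)
have /negligible_open_cover/(_ d0) [U [oU NU Ud]] :
    lambda.-negligible (~` [set t | a < t -> t < b ->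
      exists2 d, is_derive t 1 phi d & d <= 0] `|` [set a; b]).
  apply: negligibleU => //; exists [set a; b]; split => //.
    apply: sub_caratheodory.
    by apply: measurableU; exact: measurable_set1.
  have := @countable_lebesgue_measure0 R [set a; b].
  by apply; apply: finite_set_countable; exact: finite_set2.
pose S t := [/\ a <= t, t <= b & exists2 s, interval_chain U a t s &
  phi t - phi a <= e' * (t - a) + \sum_(i <- s) `|phi i.2 - phi i.1|].
have Sa : S a.
  by split => //; exists [::] => /=; rewrite ?big_nil ?subrr ?mulr0 ?addr0.
(* Membership in [S] passes from just left of [c] to just right of it: inside [U] by adding an
   interval to the chain, elsewhere by [straddle]. *)
have local c : a <= c -> c <= b -> exists2 rho, 0 < rho & forall s t,
    c - rho < s -> s <= c -> c <= t -> t < c + rho -> a <= s -> t <= b ->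
    S s -> S t.
  move=> ac cb; have [cU|cU] := pselect (U c).
    have /nbhs_ballP[rho /= rho0 rhoU] : nbhs c U by exact: open_nbhs_nbhs.
    exists rho => // s t rs sc ct tr as_ tb [_ _ [q qch phis]].
    split => //; first exact: le_trans ct.
    exists ((s, t) :: q).
      split => //=; first exact: le_trans ct.
      move=> x /=; rewrite in_itv/= => /andP[sx xt]; apply: rhoU.
      by rewrite /ball/= ltr_distlC; apply/andP; split; lra.
    rewrite big_cons /=; have := ler_norm (phi t - phi s).
    have : e' * (s - a) <= e' * (t - a) by rewrite ler_pM2l//; lra.
    by move: phis; lra.
  have [c' dc' c'0] : exists2 d, is_derive c 1 phi d & d <= 0.
    apply: contrapT => Nd; apply: cU; apply: NU.
    have [->|ac'] := eqVneq c a; first by right; left.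
    have [->|bc'] := eqVneq c b; first by right; right.
    by left => /= H; apply: Nd; apply: H; rewrite lt_neqAle ?ac ?cb ?andbT// eq_sym.
  have [rho rho0 H] := straddle dc' e'0.
  exists rho => // s t rs sc ct tr as_ tb [_ _ [q qch phis]].
  split => //; first by rewrite (le_trans as_)// (le_trans sc).
  exists q; first by apply: interval_chain_le qch; exact: le_trans ct.
  have := H _ _ rs sc ct tr.
  have : (c' + e') * (t - s) <= e' * (t - s) by apply: ler_wpM2r; lra.
  rewrite (_ : t - a = (s - a) + (t - s)) ?mulrDr; last lra.
  by move: phis; lra.
pose c := sup S.
have hS : has_sup S by split; [exists a | exists b => t []].
have ac : a <= c by apply: sup_upper_bound.
have cb : c <= b by apply: sup_le_ub; [exists a|move=> t []].
have [rho rho0 Sc] := local c ac cb.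
have [s Ss cs] := sup_adherent rho0 hS.
have Ss' : s <= c by exact: sup_upper_bound.
(* Since [t] will belong to [S], it is at most [c]; this rules out [c + rho / 2] and leaves
   [t = b]. *)
pose t := Num.min b (c + rho / 2).
have St : S t.
  apply: (Sc s) => //; rewrite /t ?le_min ?gt_min ?ge_min ?lexx//.
  - by rewrite cb lerDl divr_ge0 ?ltW.
  - by apply/orP; right; lra.
  - by case: Ss.
have tc : t <= c by exact: sup_upper_bound.
have tb : t = b.
  by move: tc; rewrite /t minEle; case: ifP => // _; rewrite gerDl leNgt divr_gt0.
move: St; rewrite tb => -[_ _ [q qch]].
have := interval_chain_increments phi_d _ _ oU Ud qch.
have : e' * (b - a) <= e / 2.
  rewrite /e' mulrAC ler_pdivrMr; last by lra.
  by rewrite ler_pM2l ?divr_gt0//; lra.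
lra.
Qed.

End absolute_continuity.

(** * Lebesgue-measurable functions and their primitives *)

(* Gives access to the completed sigma-algebra on [R], which lives in the type of
   the measure: the canonical measurable structure of [R] is the Borel one. *)
Definition carrier {d} {T : measurableType d} {R : realType}
  (m : {measure set T -> \bar R}) : measurableType d := T.

Section completion.
Context {R : realType}.
Notation mu := (@lebesgue_measure R).
Notation lambda := (@completed_lebesgue_measure R).
Notation lambdaT := (carrier lambda).

Lemma measurable_completed (Y : set R) : measurable Y -> @measurable _ lambdaT Y.
Proof. exact: sub_caratheodory. Qed.

Lemma measurable_id_completed (D : set R) :
  measurable_fun (T := lambdaT) (U := measurableTypeR R) D id.
Proof.
by move=> mD Y mY; apply: measurableI => //; exact: measurable_completed.
Qed.

Lemma measurable_fun_completed {d} {U : measurableType d} {D : set R} {f : R -> U} :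
  measurable D -> measurable_fun D f -> measurable_fun (T := lambdaT) D f.
Proof. by move=> mD mf _ Y mY; exact: (measurable_completed _ (mf mD Y mY)). Qed.

Lemma negligible_completed (N : set R) :
  lambda.-negligible N <-> mu.-negligible N.
Proof.
split=> [[A [mA A0 NA]]|[A [mA A0 NA]]]; last first.
  by exists A; split => //; exact: measurable_completed.
apply: (@negligibleS _ _ _ mu A N NA).
by apply/negligible_outer_measure.
Qed.

(** The identity is measurable from the completed to the Borel sigma-algebra, and the pushforward of
    [lambda] along it is [mu]. *)
Lemma ge0_integral_completed (D : set R) (k : R -> \bar R) : measurable D ->
  measurable_fun D k -> (forall x, D x -> 0 <= k x)%E ->
  (\int[lambda]_(x in D) k x = \int[mu]_(x in D) k x)%E.
Proof.
move=> mD mk k0.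
have k0' : {in D, forall x, (0 <= k x)%E} by move=> x /[1!inE]; exact: k0.
transitivity (\int[pushforward lambda (id : lambdaT -> measurableTypeR R)]_(x in D) k x)%E.
  by rewrite (ge0_integral_pushforward (measurable_id_completed setT) lambda mD mk k0').
apply: (eq_measure_integral mu); first exact: measurable_id_completed.
by move=> mid A mA _; reflexivity.
Qed.

Lemma completed_measurableE (A : set R) : @measurable _ lambdaT A ->
  exists2 B : set R, measurable B & mu.-negligible ((A `\` B) `|` (B `\` A)).
Proof.
have := @g_sigma_completed_algebra_genE R.
rewrite completed_caratheodory_measurable => + mA.
move=> /(congr1 (fun S => S A)) E.
have : completed_algebra_gen mu A by rewrite -E.
move=> [B mB [N mN BNA]]; exists B => //.
apply: negligibleS mN; rewrite -BNA => x [[[Bx|//] NBx]|[Bx []]]; first by [].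
by left.
Qed.

(* The exceptional set is a Borel null set absorbing, for each rational [q], the
   discrepancy between [[set t | q < h t]] and a Borel set. *)
Lemma borel_representative (h : R -> R) :
  measurable_fun (T := lambdaT) (U := measurableTypeR R) setT h ->
  exists N : set R, [/\ measurable N, mu N = 0 & measurable_fun setT (h \_ (~` N))].
Proof.
(* An enumeration of the rationals with repetitions: integers that code no rational give [0]. *)
move=> mh; pose q n : R := ratr (odflt 0 (unpickle n)).
have /choice[B BP] n : exists B : set R, measurable B /\
    mu.-negligible ((h @^-1` `]q n, +oo[ `\` B) `|` (B `\` h @^-1` `]q n, +oo[)).
  have /completed_measurableE[B mB BN] : @measurable _ lambdaT (h @^-1` `]q n, +oo[).
    by rewrite -[X in measurable X]setTI; apply: mh => //; exact: measurable_itv.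
  by exists B.
have [N [mN N0 BN]] : mu.-negligible (\bigcup_n
    ((h @^-1` `]q n, +oo[ `\` B n) `|` (B n `\` h @^-1` `]q n, +oo[))).
  by apply: negligible_bigcup => n; exact: (BP n).2.
exists N; split => //.
have mCN : measurable (~` N) by exact: measurableC.
apply/(measurable_restrictT _ mCN).
apply: (measurability _ (RGenOInfty.measurableE R)) => // _ [_ [x ->] <-].
rewrite [X in measurable X](_ : _ =
    (\bigcup_(n in [set n | x < q n]) B n) `\` N).
  by apply: measurableD => //; apply: bigcup_measurable => n _; exact: (BP n).1.
have hB t n : ~ N t -> B n t <-> q n < h t.
  move=> Nt; have hq : (h @^-1` `]q n, +oo[) t <-> q n < h t.
    by rewrite /= in_itv/= andbT.
  rewrite -hq; split=> [Bt|ht]; apply: contrapT => H; apply: Nt; apply: BN;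
    exists n => //; [right|left]; by split.
apply/seteqP; split=> t /=.
  rewrite in_itv/= andbT => -[Nt /rat_in_itvoo[r]].
  rewrite in_itv/= => /andP[xr rh]; split => //.
  by exists (pickle r); rewrite /= ?hB// /q pickleK.
move=> [[n /= xn] Bn Nt]; split => //; rewrite in_itv/= andbT.
by apply: lt_trans xn _; apply/hB.
Qed.

End completion.

Section primitive.
Context {R : realType}.
Notation mu := (@lebesgue_measure R).
Notation lambda := (@completed_lebesgue_measure R).
Notation lambdaT := (carrier lambda).

(** Split [E] along a sublevel set [F n]: outside it the integral is small by monotone convergence,
    inside it the integrand is at most [n], so that a small [m E] suffices. *)
Lemma integral_small_measure {d} {T : measurableType d} (m : {measure set T -> \bar R})
    (D : set T) (k : T -> R) (e : R) : measurable D ->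
  m.-integrable D (EFin \o k) -> (forall x, D x -> 0 <= k x) -> 0 < e ->
  exists2 r, 0 < r & forall E, measurable E -> E `<=` D -> (m E < r%:E)%E ->
    (\int[m]_(x in E) (k x)%:E < e%:E)%E.
Proof.
move=> mD ik k0 e0.
have /integrableP[mk _] := ik.
have mk' : measurable_fun D k by exact/measurable_EFinP.
pose F n := D `&` [set x | k x <= n%:R].
have mF n : measurable (F n).
  have := mk' mD `]-oo, n%:R]%classic (measurable_itv _).
  by congr measurable; apply/seteqP; split => x [Dx] /=; rewrite in_itv.
have FD : \bigcup_n F n = D.
  apply/seteqP; split => [x [n _ []//]|x Dx].
  exists (Num.bound (k x)) => //; split => //=.
  exact: ltW (archi_boundP (k0 x Dx)).
have ndF : nondecreasing_seq F.
  move=> n p np; rewrite subsetEset => x [Dx /= kn]; split => //=.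
  by rewrite (le_trans kn)// ler_nat.
set I := (\int[m]_(x in D) (k x)%:E)%E.
have cvI : (\int[m]_(x in F n) (k x)%:E)%E @[n --> \oo] --> I.
  rewrite /I -FD; apply: ge0_nondecreasing_set_cvg_integral => //.
    by move=> n; apply: measurable_funS mk => // x [].
  by move=> n x [Dx _]; rewrite lee_fin k0.
have Ifin : I \is a fin_num by exact: integrable_fin_num.
have e20 : 0 < e / 2 by rewrite divr_gt0.
have [n In] : exists n, (I - (e / 2)%:E < \int[m]_(x in F n) (k x)%:E)%E.
  apply/not_existsP => H.
  have : (I <= I - (e / 2)%:E)%E.
    by apply: cvge_to_le cvI _; apply: nearW => n; rewrite leNgt; exact/negP/H.
  by rewrite leNgt lteBlDr// lteDl// lte_fin e20.
exists (e / 2 / n.+1%:R); first by rewrite divr_gt0.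
move=> E mE ED Er.
have mEF : measurable (E `&` F n) by exact: measurableI.
have mEDF : measurable (E `\` F n) by exact: measurableD.
rewrite -(setUIDK E (F n)) ge0_integral_setU//=; last 3 first.
- by rewrite setUIDK; apply: measurable_funS mk.
- by move=> x [[/ED Dx _]|[/ED Dx _]]; rewrite lee_fin k0.
- by apply/disj_setPS => x [[_ ?] [_]].
rewrite (splitr e) EFinD; apply: lte_leD => //.
- by apply: integrable_fin_num => //; apply: integrableS ik => // x [/ED].
- apply: (@le_lt_trans _ _ (\int[m]_(x in E `&` F n) n.+1%:R%:E)%E).
    apply: ge0_le_integral => //.
    + by move=> x [Ex _]; rewrite lee_fin k0//; exact: ED.
    + by apply: measurable_funS mk => // x [] /ED.
    + by move=> x [_ [_ /= kx]]; rewrite lee_fin (le_trans kx)// ler_nat.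
  rewrite integral_cst//.
  apply: (@le_lt_trans _ _ (n.+1%:R%:E * m E)%E).
    by rewrite lee_pmul2l// le_measure ?inE.
  by rewrite -lte_pdivlMl// -EFinM mulrC.
- have : (\int[m]_(x in E `\` F n) (k x)%:E + \int[m]_(x in F n) (k x)%:E <= I)%E.
    rewrite -ge0_integral_setU//=.
    + apply: ge0_subset_integral => //.
      * exact: measurableU.
      * by move=> x [[/ED//]|[]].
    + by apply: measurable_funS mk => // x [[/ED//]|[]].
    + by move=> x [[/ED Dx _]|[Dx _]]; rewrite lee_fin k0.
    + by apply/disj_setPS => x [[_ ?] ?].
  have Fnfin : (\int[m]_(x in F n) (k x)%:E)%E \is a fin_num.
    by apply: integrable_fin_num => //; apply: integrableS ik => // x [].
  rewrite -leeBrDr// => /le_trans; apply.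
  by rewrite leeBlDl// -leeBlDr// ltW.
Qed.

Context {t0 : R} {g : R -> R}.

Lemma half_line_bigcup : `[t0, +oo[%classic = \bigcup_n (`[t0, n%:R]%classic : set R).
Proof.
apply/seteqP; split => t /=; last by move=> [n _ /=]; rewrite !in_itv/= andbT => /andP[].
rewrite !in_itv/= andbT => t0t; exists (Num.bound `|t|) => //=.
rewrite in_itv/= t0t/= ltW// (le_lt_trans (ler_norm t))//.
by apply: archi_boundP.
Qed.

Hypothesis g_ge0 : forall t, t0 <= t -> 0 <= g t.
Hypothesis g_int : forall b, lambda.-integrable `[t0, b] (EFin \o g).

Lemma measurable_fun_half_line :
  measurable_fun (T := lambdaT) (U := measurableTypeR R) `[t0, +oo[ g.
Proof.
rewrite half_line_bigcup; apply/(measurable_fun_bigcup (T1 := lambdaT)) => n.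
  exact: (measurable_completed _ (measurable_itv _)).
by have /integrableP[/measurable_EFinP] := g_int n%:R.
Qed.

(** Extending [g] by 0 left of [t0] ([h]) and then putting 0 on a Borel null set ([k]) gives a Borel
    function integrable on every []-oo, y]]. The differentiation theorem applies to [k], which has
    the same integrals and agrees with [g] almost everywhere right of [t0]. *)
Lemma locally_integrable_primitive : exists A : R -> R,
  [/\ forall b, (A b)%:E = (\int[lambda]_(t in `[t0, b]) (g t)%:E)%E,
      forall s t, s <= t -> A s <= A t,
      forall b, absolutely_continuous t0 b A &
      {ae lambda, forall t : R, t0 < t -> is_derive t 1 A (g t)}].
Proof.
pose h := g \_ (`[t0, +oo[ : set R).
have mh : measurable_fun (T := lambdaT) (U := measurableTypeR R) setT h.
  have mD : @measurable _ lambdaT `[t0, +oo[.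
    exact: (measurable_completed _ (measurable_itv _)).
  exact: (iffLR (measurable_restrictT (T1 := lambdaT) (T2 := measurableTypeR R) g mD)
    measurable_fun_half_line).
have [N [mN N0 mk]] := borel_representative h mh.
set k := h \_ (~` N) in mk.
have h_ge0 t : 0 <= h t.
  by rewrite /h patchE; case: ifPn => // /[!inE]/=; rewrite in_itv/= andbT => /g_ge0.
have k_ge0 t : 0 <= k t by rewrite /k patchE; case: ifPn.
have kg y : (\int[mu]_(t in `]-oo, y]) (k t)%:E = \int[lambda]_(t in `[t0, y]) (g t)%:E)%E.
  have mE : measurable_fun (`]-oo, y]%classic : set R) (EFin \o k).
    by apply/measurable_EFinP; exact: measurable_funTS.
  rewrite -ge0_integral_completed//; last by move=> x _; rewrite lee_fin.
  transitivity (\int[lambda]_(t in `]-oo, y]) (h t)%:E)%E.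
    apply: ge0_ae_eq_integral.
    - exact: (measurable_completed _ (measurable_itv _)).
    - exact: measurable_fun_completed mE.
    - by apply/measurable_EFinP; apply: measurable_funTS.
    - by move=> x _; rewrite lee_fin.
    - by move=> x _; rewrite lee_fin.
    - apply/negligible_completed; exists N; split => // t /= /not_implyP[_].
      by apply: contra_notP => Nt; rewrite /k patchE mem_set.
  rewrite (_ : `[t0, y]%classic = `]-oo, y] `&` `[t0, +oo[); last first.
    apply/seteqP; split => t /=; rewrite !in_itv/= andbT; first by move=> /andP[].
    by move=> [-> ->].
  by rewrite integral_mkcondr; apply: eq_integral => t _; rewrite restrict_EFin.
have k_int y : mu.-integrable `]-oo, y] (EFin \o k).
  apply/integrableP; split; first by apply/measurable_EFinP; exact: measurable_funTS.
  under eq_integral do rewrite /= ger0_norm//.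
  by rewrite kg; apply: integrable_lty => //; exact: (measurable_completed _ (measurable_itv _)).
have k_loc : locally_integrable setT k.
  split => //; first exact: openT.
  move=> K _ cK.
  have [M [_ MK]] := compact_bounded cK.
  have /integrableP[_] := k_int (M + 1); apply: le_lt_trans.
  apply: ge0_subset_integral => //=.
  - exact: compact_measurable.
  - by apply/measurable_EFinP; apply: measurableT_comp => //; exact: measurable_funTS.
  - move=> x Kx /=; rewrite in_itv/=.
    by rewrite (le_trans (ler_norm x))// (MK _ _ _ Kx)// ltrDl.
exists (fun y => \int[mu]_(t in `]-oo, y]) k t); split.
- move=> b; rewrite -kg /Rintegral fineK// integrable_fin_num//.
- move=> s t st; rewrite /Rintegral fine_le ?integrable_fin_num//.
  apply: ge0_subset_integral => //=.
  + by apply/measurable_EFinP; exact: measurable_funTS.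
  + by move=> x _; rewrite lee_fin.
  + by apply: subset_itvl; rewrite bnd_simp.
- move=> b e e0.
  have [r r0 kr] := integral_small_measure mu `]-oo, b]%classic k e
    (measurable_itv _) (k_int b) (fun x _ => k_ge0 x) e0.
  exists r => // n x y xy tI sr.
  pose I i : set R := [set` `]x i, y i[].
  have mI i : measurable (I i) by exact: measurable_itv.
  have Iib i : I i `<=` `]-oo, b].
    move=> t; rewrite /I/= !in_itv/= => /andP[_ ty].
    by have [_ _] := xy i; apply: le_trans (ltW ty).
  have muI i : mu (I i) = (y i - x i)%:E.
    have [_ + _] := xy i; rewrite /I lebesgue_measure_itv/= lte_fin.
    by rewrite le_eqVlt => /predU1P[->|->//]; rewrite ltxx subrr.
  have Ieq i : `|(\int[mu]_(t in `]-oo, y i]) k t) - (\int[mu]_(t in `]-oo, x i]) k t)|%:E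
      = (\int[mu]_(t in I i) (k t)%:E)%E.
    have [_ xyi _] := xy i.
    rewrite Rintegral_itvB ?bnd_simp//.
    have ik : mu.-integrable `]x i, y i] (EFin \o k).
      by apply: integrableS (k_int (y i)) => //; apply: subset_itvr.
    rewrite ger0_norm; last by apply: Rintegral_ge0 => t _.
    rewrite /Rintegral fineK ?integrable_fin_num//.
    by rewrite -integral_itv_bndo_bndc//; apply/measurable_EFinP; exact: measurable_funTS.
  rewrite -lte_fin -sumEFin (eq_bigr _ (fun i _ => Ieq i)).
  rewrite -[X in (X < _)%E](ge0_integral_bigsetU mu)//.
  + apply: kr.
    * by apply: bigsetU_measurable => i _; exact: mI.
    * by rewrite -bigcup_seq => t [i _ /Iib].
    * rewrite measure_semi_additive_ord//; last first.
        by apply: bigsetU_measurable => i _; exact: mI.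
      by rewrite (eq_bigr _ (fun i _ => muI i)) sumEFin lte_fin.
  + exact: index_enum_uniq.
  + by apply: sub_trivIset tI.
  + by apply/measurable_EFinP; exact: measurable_funTS.
  + by move=> t _; rewrite lee_fin.
- pose A (y : R) : R := \int[mu]_(t in `]-oo, y]) k t.
  have H : {ae lambda, forall y : R, derivable A y 1 /\ A^`()%classic y = k y}.
    exact/negligible_completed/(FTC1Ny k_int k_loc).
  have HN : {ae lambda, forall t : R, ~ N t}.
    apply/negligible_completed; exists N; split => // t /=.
    by apply: contra_notP.
  have FF := ae_filter_ringOfSetsType lambda.
  apply: filterS2 H HN => t [At dA] Nt t0t; apply: DeriveDef => //.
  rewrite -derive1E dA /k patchE mem_set// /h patchE mem_set//=.
  by rewrite in_itv/= ltW.
Qed.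

End primitive.

(** * Real Hilbert spaces *)

Section inner_product.
Context {R : realType} {H : normedModType R} {dot : {dot H for idfun}}.
Hypothesis hdot : norm_from_dot dot.
Implicit Types x y z : H.

Lemma dotC x y : dot x y = dot y x.
Proof. by have := hermC dot x y; rewrite expr0 mul1r. Qed.

Lemma dotDl x y z : dot (x + y) z = dot x z + dot y z.
Proof. exact: linearDl. Qed.

Lemma dotDr x y z : dot z (x + y) = dot z x + dot z y.
Proof. exact: linearDr. Qed.

Lemma dotNl x z : dot (- x) z = - dot x z.
Proof. exact: linearNl. Qed.

Lemma dotNr x z : dot z (- x) = - dot z x.
Proof. exact: linearNr. Qed.

Lemma dotZl (a : R) x z : dot (a *: x) z = a * dot x z.
Proof. exact: linearZl_LR. Qed.

Lemma dotZr (a : R) x z : dot z (a *: x) = a * dot z x.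
Proof. by rewrite dotC dotZl dotC. Qed.

Definition dot_linear := (dotDl, dotDr, dotNl, dotNr, dotZl, dotZr).

Lemma sqr_norm_dot x : `|x| ^+ 2 = dot x x.
Proof.
rewrite hdot sqr_sqrtr//; have [->|/neq0_dnorm_gt0/ltW//] := eqVneq x 0.
by rewrite linear0l.
Qed.

Lemma sqr_normD x y : `|x + y| ^+ 2 = `|x| ^+ 2 + 2 * dot x y + `|y| ^+ 2.
Proof. by rewrite !sqr_norm_dot !dot_linear (dotC y x); ring. Qed.

Lemma sqr_normB x y : `|x - y| ^+ 2 = `|x| ^+ 2 - 2 * dot x y + `|y| ^+ 2.
Proof. by rewrite sqr_normD dotNr normrN mulrN. Qed.

Lemma dot_le_norm x y : dot x y <= `|x| * `|y|.
Proof.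
have [->|x0] := eqVneq x 0; first by rewrite linear0l normr0 mul0r.
have [->|y0] := eqVneq y 0; first by rewrite linear0r normr0 mulr0.
have xy0 : 0 < `|x| * `|y| by rewrite mulr_gt0 ?normr_gt0.
have := sqr_ge0 `| `|y| *: x - `|x| *: y|.
rewrite sqr_normB !dot_linear !normrZ !normr_id => h.
have {}h : 0 <= 2 * (`|x| * `|y|) * (`|x| * `|y| - dot x y) by move: h; lra.
by rewrite -subr_ge0; move: h; rewrite pmulr_rge0// mulr_gt0.
Qed.

Lemma normr_dot_le x y : `|dot x y| <= `|x| * `|y|.
Proof.
rewrite ler_norml dot_le_norm andbT lerNl -dotNl (le_trans (dot_le_norm _ _))//.
by rewrite normrN.
Qed.

Lemma cvg_dot {I : Type} {F : set_system I} {FF : Filter F} {a b : I -> H} {x y : H} :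
  a i @[i --> F] --> x -> b i @[i --> F] --> y ->
  dot (a i) (b i) @[i --> F] --> dot x y.
Proof.
move=> ax bY; apply/cvgrPdist_le => e e0.
pose d := Num.min 1 (e / (`|x| + `|y| + 1)).
have xy0 : 0 < `|x| + `|y| + 1 by rewrite ltr_wpDl// addr_ge0.
have d0 : 0 < d by rewrite lt_min ltr01 divr_gt0.
have d1 : d <= 1 by rewrite ge_min lexx.
have de : d * (`|x| + `|y| + 1) <= e by rewrite -ler_pdivlMr// ge_min lexx orbT.
have /cvgr_dist_le/(_ d d0) axd := ax.
have /cvgr_dist_le/(_ d d0) byd := bY.
apply: filterS2 axd byd => i axd byd.
have -> : dot x y - dot (a i) (b i) =
    dot x (y - b i) + dot (x - a i) y - dot (x - a i) (y - b i).
  by rewrite !dot_linear; ring.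
apply: le_trans (ler_normB _ _) _.
have h1 : `|dot x (y - b i) + dot (x - a i) y| <= `|x| * d + d * `|y|.
  rewrite (le_trans (ler_normD _ _))// lerD// (le_trans (normr_dot_le _ _))//.
    by rewrite ler_wpM2l.
  by rewrite ler_wpM2r.
have h2 : `|dot (x - a i) (y - b i)| <= d * 1.
  by rewrite (le_trans (normr_dot_le _ _))// ler_pM// (le_trans byd).
lra.
Qed.

Lemma is_derive_cvg {V : normedModType R} {w : R -> V} {t : R} {dw : V} :
  is_derive t 1 w dw <-> h^-1 *: (w (h + t) - w t) @[h --> 0^'] --> dw.
Proof.
have E : (fun h : R => h^-1 *: ((w \o shift t) (h *: 1) - w t)) =
    (fun h => h^-1 *: (w (h + t) - w t)).
  by apply/funext => h /=; rewrite [h *: 1]mulr1.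
split=> [[]|wt].
  by rewrite /derivable /derive E => /cvg_ex[l /= wl] <-; rewrite (cvg_lim (@norm_hausdorff _ _) wl).
apply: DeriveDef; first by rewrite /derivable E; apply/cvg_ex; exists dw.
by rewrite /derive E; apply: cvg_lim => //; exact: norm_hausdorff.
Qed.

Lemma is_derive_dotl {w : R -> H} {t : R} {dw : H} (e : H) : is_derive t 1 w dw ->
  is_derive t 1 (fun s => dot (w s) e : R) (dot dw e).
Proof.
move=> /is_derive_cvg wt; apply/is_derive_cvg.
have E : (fun h : R => dot (h^-1 *: (w (h + t) - w t)) e) =
    (fun h => h^-1 *: (dot (w (h + t)) e - dot (w t) e)).
  by apply/funext => h; rewrite !dot_linear.
by rewrite -E; exact: cvg_dot wt (cvg_cst e).
Qed.

(** The identity [|a - x|^2 - |b - x|^2 = <a + b - 2 x, a - b>] turns the difference quotient into a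
    single inner product, whose limit is given by [cvg_dot]. *)
Lemma is_derive_sqr_norm {w : R -> H} {t : R} {dw : H} (x : H) : is_derive t 1 w dw ->
  is_derive t 1 (fun s => `|w s - x| ^+ 2 : R) (2 * dot (w t - x) dw).
Proof.
move=> wdw; have wt : w (h + t) @[h --> 0^'] --> w t.
  have /derivable1_diffP/differentiable_continuous : derivable w t 1 by case: wdw.
  move=> wt; apply: (@cvg_comp _ _ _ (fun h => h + t) w _ (nbhs t)); last exact: wt.
  apply: cvg_within_filter.
  have : (h + t) @[h --> (0 : R)] --> 0 + t by apply: cvgD; [exact: cvg_id|exact: cvg_cst].
  by rewrite add0r.
move/is_derive_cvg : wdw => wdw; apply/is_derive_cvg.
have := cvg_dot (cvgB (cvgD wt (cvg_cst (w t))) (cvg_cst (2 *: x))) wdw.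
have -> : dot (w t + w t - 2 *: x) dw = 2 * dot (w t - x) dw.
  by rewrite !dot_linear; ring.
have -> : (fun h : R => dot (w (h + t) + w t - 2 *: x) (h^-1 *: (w (h + t) - w t))) =
    (fun h => h^-1 *: (`|w (h + t) - x| ^+ 2 - `|w t - x| ^+ 2)).
  apply/funext => h; rewrite dotZr; congr (_ * _).
  move: (w (h + t)) (w t) => a b.
  by rewrite !sqr_norm_dot !dot_linear (dotC x a) (dotC x b) (dotC b a); ring.
by apply.
Qed.

End inner_product.

(** * Riesz representation, weak limits along ultrafilters, Opial's argument *)

Section weak_limits.
Context {R : realType} {H : completeNormedModType R} {dot : {dot H for idfun}}.
Hypothesis hdot : norm_from_dot dot.
Implicit Types x y z : H.
Notation hN := (sqr_norm_dot hdot).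

(* The representing vector minimises [|y|^2 - 2 L y]. *)
Lemma riesz_representation {L : H -> R} {M : R} :
  (forall x y, L (x + y) = L x + L y) -> (forall (a : R) x, L (a *: x) = a * L x) ->
  (forall x, `|L x| <= M * `|x|) -> exists x, forall y, L y = dot x y.
Proof.
move=> LD LZ LM; pose J y := `|y| ^+ 2 - 2 * L y.
have JM y : - M ^+ 2 <= J y.
  have := LM y; rewrite ler_norml => /andP[_ Ly].
  have := sqr_ge0 (`|y| - M); rewrite /J; nra.
pose S := range J.
have hS : has_inf S by split; [exists (J 0), 0|exists (- M ^+ 2) => _ [y _ <-]].
pose m := inf S.
have mJ y : m <= J y by apply: ge_inf; [case: hS|exists y].
(* By the parallelogram identity and [m <= J] at the midpoint, near-minimisers are close to each
   other. *)
have Jpar a b : `|a - b| ^+ 2 <= 2 * (J a - m) + 2 * (J b - m).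
  have := mJ (2^-1 *: (a + b)); rewrite /J LZ LD normrZ exprMn.
  have -> : `|(2^-1 : R)| ^+ 2 = 4^-1 by rewrite ger0_norm ?invr_ge0//; field.
  by rewrite (sqr_normB hdot) (sqr_normD hdot); lra.
have /choice[y yJ] (n : nat) : exists y, J y < m + n.+1%:R^-1.
  have n0 : (0 : R) < n.+1%:R^-1 by rewrite invr_gt0.
  by have [_ [y _ <-] yn] := inf_adherent n0 hS; exists y.
have : cvg (y n @[n --> \oo]).
  apply: cauchy_cvg; apply: cauchy_exP => e /= e0.
  (* [Jpar] bounds [|y N - y n|^2] by [2 / (N + 1) + 2 / (n + 1) <= 4 / (N + 1)]. *)
  have [N _ Ne] : \forall N \near \oo, N.+1%:R^-1 < e ^+ 2 / 4.
    apply: (@near_infty_natSinv_lt R (PosNum (_ : 0 < e ^+ 2 / 4))).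
    by rewrite divr_gt0// exprn_gt0.
  exists (y N), N => // n /= Nn; rewrite -ball_normE/= -ltr_sqr ?nnegrE ?(ltW e0)//.
  have := Jpar (y N) (y n); have := yJ N; have := yJ n.
  have : n.+1%:R^-1 <= N.+1%:R^-1 :> R by rewrite lef_pV2 ?posrE// ler_nat.
  have := Ne N (leqnn N) => /=; move: (n.+1%:R^-1) (N.+1%:R^-1) => i j; lra.
move=> /cvg_ex[x /= yx]; exists x.
have Jx : J x <= m.
  have Jyx : J (y n) @[n --> \oo] --> J x.
    rewrite /J; apply: cvgB.
      under eq_fun do rewrite hN.
      by rewrite hN; have yxx := cvg_dot hdot yx yx; exact: yxx.
    apply: cvgMr; apply/cvgrPdist_le => e e0.
    have M0 : 0 < `|M| + 1 by rewrite ltr_wpDl.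
    have /cvgrPdist_le/(_ _ (divr_gt0 e0 M0)) := yx.
    apply: filterS => n xn.
    have -> : L x - L (y n) = L (x - y n) by rewrite LD -[- y n]scaleN1r LZ mulN1r.
    apply: (le_trans (LM _)); apply: (@le_trans _ _ ((`|M| + 1) * `|x - y n|)).
      by rewrite ler_wpM2r// (le_trans (ler_norm M))// lerDl.
    by rewrite -ler_pdivlMl// mulrC.
  have m1 : m + n.+1%:R^-1 @[n --> \oo] --> m + 0.
    by apply: cvgD; [exact: cvg_cst|exact: cvg_harmonic].
  rewrite -[m]addr0; apply: ler_cvg_to Jyx m1 _.
  by apply: nearW => n; exact: ltW.
move=> z; pose c := dot x z - L z; apply/eqP; rewrite -subr_eq0 -oppr_eq0 opprB -/c.
pose N := `|z| ^+ 2.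
have N0 : 0 < N + 1 by rewrite ltr_wpDl// sqr_ge0.
(* [J (x + s z) - J x = s^2 N + 2 s c] is least at [s = - c / N]; the denominator [N + 1] also
   covers [z = 0], and the value stays negative unless [c = 0]. *)
pose s := - c / (N + 1).
have : 0 <= s ^+ 2 * N + 2 * s * c.
  have := le_trans Jx (mJ (x + s *: z)).
  rewrite /J (sqr_normD hdot) normrZ exprMn real_normK ?num_real// LD LZ dotZr// -/N.
  by rewrite /c; lra.
have -> : s ^+ 2 * N + 2 * s * c = - (c ^+ 2) * ((N + 2) / (N + 1) ^+ 2).
  by rewrite /s; field; rewrite gt_eqF.
rewrite mulNr oppr_ge0 pmulr_lle0; last first.
  by rewrite divr_gt0 ?exprn_gt0// ltr_wpDl// sqr_ge0.
by move=> c2; rewrite -sqrf_eq0 eq_le c2 sqr_ge0.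
Qed.

(* Banach-Saks: if the conclusion fails, sums [S] of [p] well chosen terms have
   [dot S z] of order [p], but norm only of order [sqrt p]. *)
Lemma almost_orthogonal_weak_cvg0 {y : nat -> H} {C : R} :
  (forall n, `|y n| <= C) ->
  (forall i j, (i < j)%N -> `|dot (y j) (y i)| <= j.+1%:R^-1) ->
  forall z, dot (y n) z @[n --> \oo] --> (0 : R).
Proof.
move=> yC yo; have C0 : 0 <= C by rewrite (le_trans _ (yC 0%N)).
suff main z e : 0 < e -> \forall n \near \oo, dot (y n) z < e.
  move=> z; apply/cvgrPdist_lt => e e0.
  apply: filterS2 (main z e e0) (main (- z) e e0) => n.
  by rewrite dotNr sub0r normrN ltr_norml => -> ?; rewrite andbT ltrNl.
move=> e0; apply: contrapT => Ninf.
have {}Ninf N : exists2 n, (N <= n)%N & e <= dot (y n) z.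
  apply: contrapT => H1; apply: Ninf; exists N => // n /= Nn.
  by rewrite ltNge; apply/negP => H2; apply: H1; exists n.
(* The last clause keeps later terms nearly orthogonal to [S]; taking the next index [j >= p] makes
   the cross term [2 dot (y j) S] at most 2, the source of [C ^+ 2 + 2]. *)
have HS p : exists S N, [/\ `|S| ^+ 2 <= p%:R * (C ^+ 2 + 2), p%:R * e <= dot S z &
    forall j, (N <= j)%N -> `|dot (y j) S| <= p%:R * j.+1%:R^-1].
  elim: p => [|p [S [N [Sn Sz So]]]].
    exists 0, 0%N; rewrite !mul0r normr0 expr0n/= linear0l lexx; split => // j _.
    by rewrite linear0r normr0 mul0r.
  have [j Nj jz] := Ninf (maxn N p); move: Nj; rewrite geq_max => /andP[Nj pj].
  exists (S + y j), (maxn N j.+1); split.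
  - rewrite (sqr_normD hdot) (dotC S) -natr1.
    have dS : dot (y j) S <= 1.
      rewrite (le_trans (ler_norm _))// (le_trans (So j Nj))//.
      by rewrite ler_pdivrMr// mul1r ler_nat leqW.
    have yj : `|y j| ^+ 2 <= C ^+ 2 by rewrite lerXn2r ?nnegrE.
    by rewrite mulrDl mul1r; lra.
  - by rewrite dotDl -natr1 mulrDl mul1r lerD.
  - move=> k; rewrite geq_max => /andP[Nk jk].
    rewrite dotDr -natr1 mulrDl mul1r (le_trans (ler_normD _ _))// lerD//.
      exact: So.
    exact: yo.
pose K := (C ^+ 2 + 2) * `|z| ^+ 2.
have K0 : 0 <= K by rewrite mulr_ge0 ?addr_ge0 ?sqr_ge0.
(* Cauchy-Schwarz will give [(p e)^2 <= p K], which fails once [p > K / e^2]. *)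
pose p := (Num.bound (K / e ^+ 2)).+1.
have [S [N [Sn Sz _]]] := HS p.
have p0 : 0 < p%:R :> R by rewrite ltr0n.
have Kp : K < p%:R * e ^+ 2.
  rewrite -ltr_pdivrMr ?exprn_gt0//.
  by rewrite (lt_le_trans (archi_boundP _)) ?divr_ge0 ?sqr_ge0// ler_nat.
have := le_trans Sz (dot_le_norm hdot S z).
rewrite -(@ler_pXn2r _ 2%N) ?nnegrE ?mulr_ge0 ?(ltW e0)// exprMn exprMn => h.
have : p%:R * (p%:R * e ^+ 2) <= p%:R * K :> R.
  rewrite mulrA -expr2 (le_trans h)// /K mulrA.
  by rewrite ler_wpM2r ?sqr_ge0.
by rewrite ler_pM2l// leNgt Kp.
Qed.

Lemma real_cvg_unique {T : Type} {G : set_system T} {GP : ProperFilter G}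
    {f : T -> R} {a b : R} : f t @[t --> G] --> a -> f t @[t --> G] --> b -> a = b.
Proof.
move=> fa fb; rewrite -(cvg_lim (@Rhausdorff R) fa).
by apply: cvg_lim fb; exact: Rhausdorff.
Qed.

(** Compactness of a segment gives a cluster point, and a cluster point of an ultrafilter is a
    limit. *)
Lemma ultra_bounded_cvg {T : Type} {G : set_system T} {GU : UltraFilter G}
    {f : T -> R} {K : R} : (\forall t \near G, `|f t| <= K) ->
  exists l : R, f t @[t --> G] --> l.
Proof.
move=> fK; have cK := @segment_compact R (- K) K.
have [|l [_ lf]] := cK (f t @[t --> G]) _.
  by apply: filterS fK => t; rewrite ler_norml /= in_itv.
exists l => V Vl.
have [//|NV] := in_ultra_setVsetC (f @^-1` V) GU.
by have [z [NVz Vz]] := lf (~` V) V NV Vl.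
Qed.

(** Along an ultrafilter [dot (u t) y] converges for all [y] at once, with no diagonal extraction;
    the limits form a bounded linear functional, which Riesz represents. *)
Lemma ultra_weak_cvg {T : Type} {G : set_system T} {GU : UltraFilter G}
    {u : T -> H} {C : R} : (\forall t \near G, `|u t| <= C) ->
  exists x, weak_cvg dot G u x.
Proof.
move=> uC.
have uy y : \forall t \near G, `|dot (u t) y| <= C * `|y|.
  apply: filterS uC => t ut; rewrite (le_trans (normr_dot_le hdot _ _))//.
  by rewrite ler_wpM2r.
have /choice[L Lu] : forall y, exists l : R, dot (u t) y @[t --> G] --> l.
  by move=> y; exact: ultra_bounded_cvg (uy y).
have [x xL] : exists x, forall y, L y = dot x y.
  apply: (@riesz_representation _ C).
  - move=> x y; apply: real_cvg_unique (Lu (x + y)) _.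
    under eq_fun do rewrite dotDr; exact: cvgD.
  - move=> a x; apply: real_cvg_unique (Lu (a *: x)) _.
    by under eq_fun do rewrite dotZr; apply: cvgMr.
  - by move=> x; apply: cvgr_to_le (cvg_norm (Lu x)) _; exact: uy.
by exists x => y; rewrite -xL.
Qed.

(** Demiclosedness speaks of sequences. Times are picked one by one so that [u t - x] is almost
    orthogonal to the finitely many earlier differences; [almost_orthogonal_weak_cvg0] then
    applies. *)
Lemma weak_cvg_subsequence {G : set_system R} {GF : ProperFilter G} {u : R -> H}
    {x : H} {t0 C : R} : pinfty_nbhs R `<=` G -> (forall t, t0 <= t -> `|u t| <= C) ->
  weak_cvg dot G u x ->
  exists t_ : nat -> R, t_ n @[n --> \oo] --> +oo /\ weak_cvg dot \oo (u \o t_) x.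
Proof.
move=> GF_oo uC ux.
have /choice[next nextP] (s : seq R) : exists t, [/\ t0 <= t, (size s)%:R <= t &
    forall r, r \in s -> `|dot (u t - x) (u r - x)| <= (size s).+1%:R^-1].
  have : \forall t \near G, [/\ t0 <= t, (size s)%:R <= t &
      forall r, r \in s -> `|dot (u t - x) (u r - x)| <= (size s).+1%:R^-1].
    have h1 : \forall t \near G, t0 <= t by apply: GF_oo; exact: nbhs_pinfty_ge (num_real _).
    have h2 : \forall t \near G, (size s)%:R <= t by apply: GF_oo; exact: nbhs_pinfty_ge (num_real _).
    have e0 : 0 < (size s).+1%:R^-1 :> R by rewrite invr_gt0.
    move: _%:R^-1 e0 => e e0.
    suff h3 (q : seq R) : \forall t \near G, forall r, r \in q ->
        `|dot (u t - x) (u r - x)| <= e.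
      by apply: filterS3 h1 h2 (h3 s).
    elim: q => [|r q ih]; first exact: nearW.
    have /cvgrPdist_le/(_ _ e0) := ux (u r - x).
    apply: filterS2 ih => t ih tr r'; rewrite inE => /predU1P[->|]; last exact: ih.
    by rewrite dotDl dotNl distrC.
  by move=> /filter_ex.
pose ss n := iter n (fun s => next s :: s) [::].
have size_ss n : size (ss n) = n by elim: n => //= n ->.
pose t_ n := next (ss n).
have t_ss i j : (i < j)%N -> t_ i \in ss j.
  elim: j => // j ih; rewrite ltnS leq_eqVlt => /predU1P[->|/ih tij] /=.
    by rewrite mem_head.
  by rewrite inE tij orbT.
exists t_; split.
  apply/cvgryPge => A; near=> n.
  have [_ + _] := nextP (ss n); rewrite size_ss; apply: le_trans.
  by near: n; exact: nbhs_infty_ger.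
have h y : dot (u (t_ n) - x) y @[n --> \oo] --> (0 : R).
  apply: (@almost_orthogonal_weak_cvg0 _ (C + `|x|)).
    move=> n; rewrite (le_trans (ler_normB _ _))// lerD2r uC//.
    by have [] := nextP (ss n).
  move=> i j ij; have [_ _] := nextP (ss j); rewrite size_ss; apply.
  exact: t_ss.
move=> y; have hy := cvgD (h y) (cvg_cst (dot x y)); rewrite add0r in hy.
have -> : (fun n => dot ((u \o t_) n) y) = (fun n => dot (u (t_ n) - x) y + dot x y).
  by apply/funext => n; rewrite dotDl dotNl subrK.
exact: hy.
Unshelve. all: by end_near. Qed.

(* Opial's argument: distinct weak cluster points [x1], [x2] in [F] would give
   [dot (u t) (x1 - x2)] two limits, although the polarised distances converge. *)
Lemma opial {F : set H} {u : R -> H} {t0 C : R} :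
  (forall t, t0 <= t -> `|u t| <= C) ->
  (forall x, F x -> cvg (`|u t - x| ^+ 2 @[t --> +oo])) ->
  (forall (t_ : nat -> R) x, t_ n @[n --> \oo] --> +oo ->
    weak_cvg dot \oo (u \o t_) x -> F x) ->
  exists2 x, F x & weak_cvg dot +oo u x.
Proof.
move=> uC uF Fcl.
have weak_limit (G : set_system R) : UltraFilter G -> pinfty_nbhs R `<=` G ->
    exists2 x, F x & weak_cvg dot G u x.
  move=> GU Goo.
  have [x ux] : exists x, weak_cvg dot G u x.
    apply: (@ultra_weak_cvg _ _ _ _ C).
    by apply: Goo; apply: filterS (nbhs_pinfty_ge (num_real t0)) => t; exact: uC.
  have [t_ [t_oo ut_]] := weak_cvg_subsequence Goo uC ux.
  by exists x => //; exact: Fcl ut_.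
have [G [GU Goo]] := @ultraFilterLemma R (pinfty_nbhs R) _.
have [x Fx ux] := weak_limit G GU Goo.
exists x => // y; apply/cvgrPdist_le => e e0; apply: contrapT => NB.
set B := (B in ~ pinfty_nbhs R B) in NB.
(* If weak convergence fails, the times outside [B] are unbounded, and an ultrafilter on them has a
   weak limit [x']; the equality [x = x'] then contradicts the choice of [B]. *)
have G0P : ProperFilter (within (~` B) (pinfty_nbhs R)).
  split; last exact: within_filter.
  by move=> H0; apply: NB; apply: (@filterS _ (pinfty_nbhs R) _ _ _ _ H0) => t; exact: contrapT.
have [G' [GU' G0']] := ultraFilterLemma G0P.
have Goo' : pinfty_nbhs R `<=` G'.
  by move=> P HP; apply: G0'; apply: (@filterS _ (pinfty_nbhs R) _ _ _ _ HP) => t.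
have [x' Fx' ux'] := weak_limit G' GU' Goo'.
have xx' : x = x'.
  have [l ll] : exists l, dot (u t) (x - x') @[t --> +oo] --> (l : R).
    have /cvg_ex[a /= xa] := uF _ Fx; have /cvg_ex[b /= xb] := uF _ Fx'.
    exists ((`|x| ^+ 2 - `|x'| ^+ 2 - (a - b)) / 2).
    have E : (fun t => dot (u t) (x - x')) = (fun t =>
        (`|x| ^+ 2 - `|x'| ^+ 2 - (`|u t - x| ^+ 2 - `|u t - x'| ^+ 2)) / 2).
      by apply/funext => t; rewrite !(sqr_normB hdot) dotDr dotNr; lra.
    rewrite E; apply: cvgMl; apply: cvgB; first exact: cvg_cst.
    exact: cvgB.
  have lx : l = dot x (x - x').
    by apply: real_cvg_unique (ux _); move=> V /ll; exact: Goo.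
  have lx' : l = dot x' (x - x').
    by apply: real_cvg_unique (ux' _); move=> V /ll; exact: Goo'.
  apply/eqP; rewrite -subr_eq0 -normr_eq0 -sqrf_eq0 hN dotDl dotNl -lx -lx' subrr.
  by [].
have /cvgrPdist_le/(_ _ e0) BG : dot (u t) y @[t --> G'] --> dot x y.
  by rewrite xx'; exact: ux'.
have NBG : G' (~` B) by apply: G0'; exact: withinT.
by have [t [Bt NBt]] := filter_ex (filterI BG NBG).
Qed.

End weak_limits.

(** * Absolutely continuous curves *)

Section absolutely_continuous_functions.
Context {R : realType}.

Lemma absolutely_continuous_increment {H : normedModType R} {a b : R} {u : R -> H} {e : R} :
  absolutely_continuous a b u -> 0 < e -> exists2 d, 0 < d &
    forall s t, a <= s -> s <= b -> a <= t -> t <= b -> `|s - t| < d -> `|u s - u t| < e.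
Proof.
move=> uac e0; have [d d0 ud] := uac e e0; exists d => // s t.
wlog st : s t / s <= t.
  move=> W as_ sb at_ tb; have [/W|/ltW/W] := leP s t; first exact.
  by rewrite distrC (distrC (u s)); apply.
move=> as_ _ _ tb; rewrite distrC ger0_norm ?subr_ge0// => std.
have := ud 1%N (fun=> s) (fun=> t).
rewrite !big_ord1 distrC; apply => //.
by move=> i j _ _ _; rewrite (ord1 i) (ord1 j).
Qed.

Lemma absolutely_continuous_dominated {H K : normedModType R} {a b M : R} {u : R -> H}
    {v : R -> K} : absolutely_continuous a b u ->
  (forall s t, a <= s -> s <= t -> t <= b -> `|v t - v s| <= M * `|u t - u s|) ->
  absolutely_continuous a b v.
Proof.
move=> uac vu e e0.
have M0 : 0 < `|M| + 1 by rewrite ltr_wpDl.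
have [d d0 ud] := uac _ (divr_gt0 e0 M0); exists d => // n l r lr tI srl.
have := ud n l r lr tI srl; rewrite ltr_pdivlMr// mulrC mulr_sumr.
apply: le_lt_trans; apply: ler_sum => i _; have [al lri rb] := lr i.
rewrite (le_trans (vu _ _ al lri rb))// ler_wpM2r//.
by rewrite (le_trans (ler_norm M))// lerDl.
Qed.

Lemma absolutely_continuousD {H : normedModType R} {a b : R} {u v : R -> H} :
  absolutely_continuous a b u -> absolutely_continuous a b v ->
  absolutely_continuous a b (fun t => u t + v t).
Proof.
move=> uac vac e e0.
have [d d0 ud] := uac _ (divr_gt0 e0 (ltr0n R 2)).
have [d' d'0 vd] := vac _ (divr_gt0 e0 (ltr0n R 2)).
exists (Num.min d d'); first by rewrite lt_min d0.
move=> n l r lr tI; rewrite lt_min => /andP[/(ud n l r lr tI) us /(vd n l r lr tI) vs].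
rewrite (splitr e); apply: le_lt_trans (ltrD us vs).
rewrite -big_split/=; apply: ler_sum => i _.
by rewrite opprD addrACA ler_normD.
Qed.

Lemma absolutely_continuousZ {a b : R} (k : R) {u : R -> R} :
  absolutely_continuous a b u -> absolutely_continuous a b (fun t => k * u t).
Proof.
move=> uac; apply: (absolutely_continuous_dominated (M := `|k|) uac) => s t _ _ _.
by rewrite -mulrBr normrM.
Qed.

Lemma absolutely_continuous_id (a b : R) : absolutely_continuous a b (id : R -> R).
Proof.
move=> e e0; exists e => // n l r lr _.
rewrite (eq_bigr (fun i => `|r i - l i|)) // => i _.
by have [_ lri _] := lr i; rewrite ger0_norm ?subr_ge0.
Qed.

Lemma absolutely_continuous_sub {H : normedModType R} {a b a' b' : R} {v : R -> H} :
  a <= a' -> b' <= b -> absolutely_continuous a b v -> absolutely_continuous a' b' v.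
Proof.
move=> aa' bb' vac e /vac[d d0 vd]; exists d => // n l r lr; apply: vd => i.
have [al lri rb] := lr i; split => //; [exact: le_trans al|exact: le_trans bb'].
Qed.

Lemma nondecreasing_bounded_increment {F : R -> R} {M e : R} :
  {homo F : s t / s <= t} -> (forall t, F t <= M) -> 0 < e ->
  exists S, forall s t, S <= s -> F t - F s < e.
Proof.
move=> Fnd FM e0.
have hS : has_sup (range F) by split; [exists (F 0), 0|exists M => _ [t _ <-]].
have [_ [S _ <-] FS] := sup_adherent e0 hS; exists S => s t Ss.
have : F t <= sup (range F) by apply: sup_upper_bound => //; exists t.
by have := Fnd _ _ Ss; move: FS; lra.
Qed.

Context {H : normedModType R} {t0 : R} {u : R -> H}.
Hypothesis u_ac : forall b, t0 < b -> absolutely_continuous t0 b u.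

(** [u] is arbitrary below [t0]; freezing it there gives a function continuous on the whole line. *)
Lemma continuous_stopped : continuous (fun t => u (Num.max t0 t)).
Proof.
move=> t; apply/cvgrPdist_lt => e e0.
have t0b : t0 < Num.max t0 t + 1 by rewrite (@le_lt_trans _ _ (Num.max t0 t)) ?le_max ?lexx// ltrDl.
have [d d0 ud] := absolutely_continuous_increment (u_ac _ t0b) e0.
apply/nbhs_ballP; exists (Num.min 1 d) => /=; first by rewrite lt_min ltr01.
move=> s; rewrite /ball/= lt_min => /andP[ts1 tsd].
have mts : `|Num.max t0 t - Num.max t0 s| <= `|t - s|.
  rewrite !maxEle; case: (leP t0 t) => ht; case: (leP t0 s) => hs //.
  - by rewrite !ger0_norm ?subr_ge0//; lra.
  - by rewrite distrC (distrC t) !ger0_norm ?subr_ge0//; lra.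
  - by rewrite subrr normr0.
apply: ud; rewrite ?le_max ?lexx//.
- by rewrite lerDl.
- have := le_trans mts (ltW ts1); rewrite distrC ler_norml => /andP[_].
  by rewrite lerBlDl.
- exact: le_lt_trans mts tsd.
Qed.

(** The point of maximum itself matters in [distance_bounded]: the energy inequality is applied up
    to time [c], with the maximum as [M]. *)
Lemma norm_attains_max (b : R) (x : H) : t0 <= b -> exists c,
  [/\ t0 <= c, c <= b & forall t, t0 <= t -> t <= b -> `|u t - x| <= `|u c - x|].
Proof.
move=> tb.
have cf : continuous (fun t => `|u (Num.max t0 t) - x|).
  move=> t; apply: cvg_norm; apply: cvgB; last exact: cvg_cst.
  exact: continuous_stopped.
have [c + cP] := EVT_max tb (continuous_subspaceT cf).
rewrite in_itv/= => /andP[t0c cb]; exists c; split => // t t0t tb'.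
by have := cP t; rewrite in_itv/= t0t tb' /= !max_r//; apply.
Qed.

Lemma bounded_on_segment (b : R) (x : H) :
  exists2 M, 0 <= M & forall t, t0 <= t -> t <= b -> `|u t - x| <= M.
Proof.
have [tb|tb] := leP t0 b; last first.
  by exists 0 => // t t0t /(le_trans t0t); rewrite leNgt tb.
by have [c [_ _ cP]] := norm_attains_max b x tb; exists `|u c - x|.
Qed.

End absolutely_continuous_functions.

(** * Measurability of the speed *)

Section speed.
Context {R : realType} {H : normedModType R} {t0 : R} {u f v : R -> H}.
Notation mu := (@lebesgue_measure R).
Notation lambda := (@completed_lebesgue_measure R).
Notation lambdaT := (carrier lambda).
Hypothesis u_ac : forall b, t0 < b -> absolutely_continuous t0 b u.
Hypothesis f_meas : strongly_measurable lambda `[t0, +oo[ f.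
Hypothesis u_derive : {ae lambda, forall t : R, t0 <= t -> is_derive t 1 u (v t + f t)}.

Lemma cvg_harmonic_dnbhs : (@harmonic R) n @[n --> \oo] --> (0 : R)^'.
Proof.
move=> P HP.
have h : \forall n \near \oo, (@harmonic R) n != 0 -> P (harmonic n).
  exact: (@cvg_harmonic R _ HP).
by apply: filterS h => n; apply; rewrite gt_eqF// harmonic_gt0.
Qed.

(** Measurability is checked on each of the finitely many level sets of [s], where the function
    agrees with a continuous one. *)
Lemma measurable_norm_simple (s k : R -> H) :
  simple_function (X := lambdaT) s -> continuous k ->
  measurable_fun (T := lambdaT) (U := measurableTypeR R) setT (fun t => `|k t - s t|).
Proof.
move=> [fs ms] ck _ Y mY; rewrite setTI.
rewrite [X in measurable X](_ : _ = \bigcup_(y in range s)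
    (s @^-1` [set y] `&` (fun t => `|k t - y|) @^-1` Y)); last first.
  apply/seteqP; split => [t Yt|t [y _ [/= <-]]//].
  by exists (s t); [exists t|split].
apply: fin_bigcup_measurable => // y _; apply: measurableI; first exact: ms.
have my : measurable_fun setT (fun t : R => `|k t - y|).
  apply: continuous_measurable_fun => t; apply: cvg_norm; apply: cvgB.
    exact: ck.
  exact: cvg_cst.
have := measurable_fun_completed measurableT my measurableT Y mY.
by rewrite setTI.
Qed.

(* [|v|] is the a.e. limit of [|n (u (t + 1/n) - u t) - s_n t|], [s_n] simple. *)
Lemma measurable_norm_speed :
  measurable_fun (T := lambdaT) (U := measurableTypeR R) `[t0, +oo[ (fun t => `|v t|).
Proof.
have [s s_simple s_cvg] := f_meas.
pose k n (t : R) := n.+1%:R *: (u (Num.max t0 (t + n.+1%:R^-1)) - u (Num.max t0 t)).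
have ck n : continuous (k n).
  have cu := continuous_stopped u_ac.
  move=> t; apply: cvgZr; apply: cvgB; last exact: cu.
  apply: (@cvg_comp _ _ _ (fun t => t + n.+1%:R^-1) (fun t => u (Num.max t0 t))
    _ (nbhs (t + n.+1%:R^-1))); last exact: cu.
  by apply: cvgD; [exact: cvg_id|exact: cvg_cst].
have [N [mN N0 HN]] : mu.-negligible (~` [set t : R | t0 <= t ->
    s n t @[n --> \oo] --> f t /\ is_derive t 1 u (v t + f t)]).
  apply/negligible_completed; apply: negligibleS (negligibleU s_cvg u_derive).
  move=> t /= /not_implyP[t0t] /not_andP[H1|H1]; [left|right] => /= H2; apply: H1.
    by apply: H2; rewrite in_itv/= t0t.
  exact: H2.
have mN' : @measurable _ lambdaT (~` N) by apply: measurable_completed; exact: measurableC.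
have mD : @measurable _ lambdaT `[t0, +oo[.
  exact: (measurable_completed _ (measurable_itv _)).
have cvgN t : t0 <= t -> ~ N t -> `|k n t - s n t| @[n --> \oo] --> `|v t|.
  move=> t0t Nt; have [st ut] : s n t @[n --> \oo] --> f t /\ is_derive t 1 u (v t + f t).
    by apply: contrapT => H1; apply: Nt; apply: HN => /(_ t0t).
  apply: cvg_norm; rewrite -[v t](addrK (f t)); apply: cvgB => //.
  move/is_derive_cvg : ut => ut; have := cvg_comp _ _ cvg_harmonic_dnbhs ut.
  have -> // : (fun h => h^-1 *: (u (h + t) - u t)) \o harmonic = k ^~ t.
  apply/funext => n; rewrite /k /harmonic/= invrK [_^-1 + t]addrC max_r; last first.
    by rewrite (le_trans t0t)// lerDl.
  by rewrite max_r.
(* [g] is a limit at every point of the half-line once the approximations are set to 0 on [N];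
   completeness of [lambda] passes its measurability on to [|v|]. *)
pose g t := if t \in N then 0 else `|v t|.
have mg : measurable_fun (T := lambdaT) (U := measurableTypeR R) `[t0, +oo[ g.
  apply: (@measurable_fun_cvg _ lambdaT R _
    (fun n t => (fun t => `|k n t - s n t|) \_ (~` N) t)) => [n|t].
    apply: measurable_funTS.
    apply: (iffLR (measurable_restrictT (T1 := lambdaT) (T2 := measurableTypeR R) _ mN')).
    by apply: measurable_funTS; exact: measurable_norm_simple.
  rewrite /= in_itv/= andbT => t0t; rewrite /g; case: ifPn => [tN|tN].
    have -> : (fun n => ((fun t => `|k n t - s n t|) \_ (~` N)) t) = cst 0.
      by apply/funext => n; rewrite patchE in_setC tN.
    exact: cvg_cst.
  under eq_fun do rewrite patchE in_setC tN.
  by apply: cvgN => //; move: tN; rewrite notin_setE.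
apply/measurable_EFinP; apply: (@ae_measurable_fun _ lambdaT R lambda _ _ (EFin \o g)).
- exact: completed_lebesgue_measure_is_complete.
- apply/negligible_completed; exists N; split => // t /= /not_implyP[_].
  by apply: contra_notP => Nt; rewrite /g memNset.
- exact/measurable_EFinP.
Qed.

Lemma measurable_quotient (a b : R -> R) : (forall t, t0 <= t -> 0 <= b t) ->
  measurable_fun (T := lambdaT) (U := measurableTypeR R) `[t0, +oo[ a ->
  measurable_fun (T := lambdaT) (U := measurableTypeR R) `[t0, +oo[ b ->
  measurable_fun (T := lambdaT) (U := measurableTypeR R) `[t0, +oo[ (fun t => a t / b t).
Proof.
move=> b0 ma mb; apply: measurable_funM; first exact: ma.
apply: (@eq_measurable_fun _ _ lambdaT _ _ (fun t => b t `^ (-1))).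
  by move=> t; rewrite inE/= in_itv/= andbT => /b0 bt; rewrite powR_inv1.
exact: (measurableT_comp (measurable_powR (-1)) mb).
Qed.

End speed.

(** * The evolution equation *)

Section evolution.
Context {R : realType} {H : completeNormedModType R} {dot : {dot H for idfun}}.
Notation lambda := (@completed_lebesgue_measure R).
Notation lambdaT := (carrier lambda).
Hypothesis hdot : norm_from_dot dot.
Context {t0 : R} {theta : R -> R} {f : R -> H} {T : H -> H} {u : R -> H}.
Hypothesis theta_ge0 : forall t, t0 <= t -> 0 <= theta t.
Hypothesis theta_loc : locally_integrable_on `[t0, +oo[ theta.
Hypothesis f_L1 : Bochner_integrable lambda `[t0, +oo[ f.
Hypothesis T_qne : quasi_nonexpansive T.
Hypothesis T_fix : Fix T !=set0.
Hypothesis u_ac : forall b : R, t0 < b -> absolutely_continuous t0 b u.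
Hypothesis u_derive : {ae lambda, forall t : R, t0 <= t ->
  is_derive t 1 u (theta t *: (T (u t) - u t) + f t)}.

Let p t := `|T (u t) - u t|.
Let w t := theta t * p t ^+ 2.

Lemma residual_energy_ge0 t : t0 <= t -> 0 <= w t.
Proof. by move=> t0t; rewrite /w mulr_ge0 ?sqr_ge0 ?theta_ge0. Qed.

Lemma measurable_segment (a b : R) : @measurable _ lambdaT `[a, b].
Proof. exact: (measurable_completed _ (measurable_itv _)). Qed.

Lemma integrable_theta b : lambda.-integrable `[t0, b] (EFin \o theta).
Proof.
apply: theta_loc; last exact: segment_compact.
by move=> t /=; rewrite !in_itv/= andbT => /andP[].
Qed.

Lemma integrable_norm_f b : lambda.-integrable `[t0, b] (EFin \o (fun t => `|f t|)).
Proof.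
have [_ If] := f_L1; apply: integrableS If.
- exact: (measurable_completed _ (measurable_itv _)).
- exact: measurable_segment.
- by move=> t /=; rewrite !in_itv/= andbT => /andP[].
Qed.

(* Neither [T] nor [T \o u] is measurable a priori: only [theta * p], the norm
   of [u' - f], is; hence the detour through [(theta * p)^2 / theta]. *)
Lemma measurable_residual_energy :
  measurable_fun (T := lambdaT) (U := measurableTypeR R) `[t0, +oo[ w.
Proof.
have mv := measurable_norm_speed u_ac f_L1.1 u_derive.
have mtheta := measurable_fun_half_line integrable_theta.
have mq := measurable_quotient _ _ theta_ge0 (measurable_funX 2 mv) mtheta.
apply: (eq_measurable_fun _ _ mq) => t; rewrite inE/= in_itv/= andbT => t0t.
rewrite normrZ ger0_norm ?theta_ge0// -/(p t) /w exprMn.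
(* Where [theta] vanishes, so does [w], and the quotient is [0] by the convention [x / 0 = 0]. *)
have [->|th0] := eqVneq (theta t) 0; first by rewrite expr0n/= !mul0r.
by field.
Qed.

Lemma residual_le {x : H} t : Fix T x -> p t <= 2 * `|u t - x|.
Proof.
move=> Fx; rewrite /p (_ : T (u t) - u t = (T (u t) - x) - (u t - x)); last first.
  by rewrite opprB addrA subrK.
by rewrite (le_trans (ler_normB _ _))// [leRHS]mulrDl mul1r lerD2r T_qne.
Qed.

(** On a segment [|u - x| <= K] by continuity, hence [p <= 2 K] and [w <= 4 K^2 theta]. This crude
    bound is what makes a primitive [W] available for the energy inequality. *)
Lemma integrable_residual_energy b : lambda.-integrable `[t0, b] (EFin \o w).
Proof.
have [x Fx] := T_fix; have [K K0 uK] := bounded_on_segment u_ac b x.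
have Iw := integrableZl (measurable_segment t0 b) (4 * K ^+ 2) (integrable_theta b).
apply: le_integrable Iw => //.
- exact: measurable_segment.
- apply/measurable_EFinP; apply: measurable_funS measurable_residual_energy.
    exact: (measurable_completed _ (measurable_itv _)).
  by move=> t /=; rewrite !in_itv/= andbT => /andP[].
- move=> t /=; rewrite in_itv/= => /andP[t0t tb].
  rewrite lee_fin !ger0_norm ?residual_energy_ge0 ?mulr_ge0 ?theta_ge0 ?sqr_ge0//.
  rewrite /w mulrC ler_wpM2r ?theta_ge0//.
  have -> : 4 * K ^+ 2 = (2 * K) ^+ 2 by rewrite exprMn; congr (_ * _); ring.
  rewrite lerXn2r ?nnegrE ?mulr_ge0 ?normr_ge0//.
  by rewrite (le_trans (residual_le t Fx))// ler_wpM2l// uK.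
Qed.

Context {W A : R -> R}.
Hypothesis W_int : forall b, (W b)%:E = (\int[lambda]_(t in `[t0, b]) (w t)%:E)%E.
Hypothesis W_nd : forall s t, s <= t -> W s <= W t.
Hypothesis W_ac : forall b, absolutely_continuous t0 b W.
Hypothesis W_derive : {ae lambda, forall t : R, t0 < t -> is_derive t 1 W (w t)}.
Hypothesis A_int : forall b, (A b)%:E = (\int[lambda]_(t in `[t0, b]) `|f t|%:E)%E.
Hypothesis A_nd : forall s t, s <= t -> A s <= A t.
Hypothesis A_ac : forall b, absolutely_continuous t0 b A.
Hypothesis A_derive : {ae lambda, forall t : R, t0 < t -> is_derive t 1 A `|f t|}.

Lemma ae_derivatives : {ae lambda, forall t : R, t0 < t ->
  [/\ is_derive t 1 u (theta t *: (T (u t) - u t) + f t),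
      is_derive t 1 W (w t) & is_derive t 1 A `|f t|]}.
Proof.
have FF := ae_filter_ringOfSetsType lambda.
apply: filterS3 u_derive W_derive A_derive => t ut Wt At t0t.
by split; [apply/ut/ltW|exact: Wt|exact: At].
Qed.

(** Expanding [|T u - x|^2 <= |u - x|^2] gives [2 <u - x, T u - u> <= - p^2], so [phi] has
    nonpositive derivative. [M] is local to [[s, t]] because the first use precedes any global
    bound. *)
Lemma energy_inequality {x : H} {M s t : R} : Fix T x -> 0 <= M -> t0 <= s -> s <= t ->
  (forall r, s <= r -> r <= t -> `|u r - x| <= M) ->
  `|u t - x| ^+ 2 + (W t - W s) <= `|u s - x| ^+ 2 + 2 * M * (A t - A s).
Proof.
move=> Fx M0 t0s st uM.
pose phi r := `|u r - x| ^+ 2 + (W r + (- (2 * M)) * A r).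
suff : phi t <= phi s by rewrite /phi; lra.
apply: (absolutely_continuous_nonincreasing st).
- have t0t1 : t0 < t + 1 by rewrite (le_lt_trans (le_trans t0s st))// ltrDl.
  apply: absolutely_continuousD; last first.
    apply: absolutely_continuousD; first exact: (absolutely_continuous_sub t0s (lexx t)).
    apply: absolutely_continuousZ.
    exact: (absolutely_continuous_sub t0s (lexx t)).
  have tt1 : t <= t + 1 by rewrite lerDl.
  have uac := absolutely_continuous_sub t0s tt1 (u_ac _ t0t1).
  (* The squared distance to [x] is [2 M]-Lipschitz on the ball of radius [M] around [x]. *)
  apply: (absolutely_continuous_dominated (M := 2 * M) uac) => q r sq qr rt.
  have -> : `|u r - x| ^+ 2 - `|u q - x| ^+ 2 = dot (u r - u q) ((u r - x) + (u q - x)).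
    rewrite !(sqr_norm_dot hdot) !dot_linear (dotC x (u r)) (dotC x (u q)).
    by rewrite (dotC (u q) (u r)); ring.
  rewrite (le_trans (normr_dot_le hdot _ _))// mulrC ler_wpM2r//.
  rewrite (le_trans (ler_normD _ _))// mulrDl mul1r lerD// uM//.
  + exact: le_trans qr.
  + exact: le_trans qr rt.
- have FF := ae_filter_ringOfSetsType lambda.
  apply: filterS ae_derivatives => r Hr sr rt.
  have [ur Wr Ar] := Hr (le_lt_trans t0s sr).
  exists (2 * dot (u r - x) (theta r *: (T (u r) - u r) + f r) +
    (w r + (- (2 * M)) * `|f r|)).
    have hu := is_derive_sqr_norm hdot x ur.
    exact: is_deriveD hu (is_deriveD Wr (is_deriveZ (- (2 * M)) Ar)).
  have urM : `|u r - x| <= M by apply: uM; exact: ltW.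
  have f_le : dot (u r - x) (f r) <= M * `|f r|.
    by rewrite (le_trans (dot_le_norm hdot _ _))// ler_wpM2r.
  have T_le : 2 * dot (u r - x) (T (u r) - u r) <= - p r ^+ 2.
    have : `|T (u r) - x| ^+ 2 <= `|u r - x| ^+ 2.
      by rewrite lerXn2r ?nnegrE// T_qne.
    rewrite (_ : T (u r) - x = (u r - x) + (T (u r) - u r)); last first.
      by rewrite [RHS]addrC addrA subrK.
    by rewrite (sqr_normD hdot) -/(p r); lra.
  have {}T_le : 2 * (theta r * dot (u r - x) (T (u r) - u r)) <= - w r.
    rewrite /w -mulrN mulrCA ler_wpM2l// theta_ge0//.
    by rewrite ltW// (le_lt_trans t0s).
  by rewrite dotDr dotZr; lra.
Qed.

(** Pairing the curve with the fixed vector [e = u t - u s] makes the estimate scalar and yields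
    [|e|] times the claim. The premise, met wherever [p >= 1 / k], gives [theta p <= k w]. *)
Lemma increment_inequality {k s t : R} : 0 <= k -> t0 <= s -> s <= t ->
  (forall r, s < r -> r < t -> p r <= k * p r ^+ 2) ->
  `|u t - u s| <= k * (W t - W s) + (A t - A s).
Proof.
move=> k0 t0s st pk; set e := u t - u s.
have t0t1 : t0 < t + 1 by rewrite (le_lt_trans (le_trans t0s st))// ltrDl.
have tt1 : t <= t + 1 by rewrite lerDl.
have uac := absolutely_continuous_sub t0s tt1 (u_ac _ t0t1).
have Wac := absolutely_continuous_sub t0s (lexx t) (W_ac t).
have Aac := absolutely_continuous_sub t0s (lexx t) (A_ac t).
pose phi r := dot (u r) e + (- (`|e| * k) * W r + (- `|e|) * A r).
have : phi t <= phi s.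
  apply: (absolutely_continuous_nonincreasing st).
    apply: absolutely_continuousD; last first.
      by apply: absolutely_continuousD; exact: absolutely_continuousZ.
    apply: (absolutely_continuous_dominated (M := `|e|) uac) => q r _ _ _.
    by rewrite -dotNl -dotDl mulrC normr_dot_le.
  have FF := ae_filter_ringOfSetsType lambda.
  apply: filterS ae_derivatives => r Hr sr rt.
  have t0r := le_lt_trans t0s sr; have [ur Wr Ar] := Hr t0r.
  exists (dot (theta r *: (T (u r) - u r) + f r) e +
      (- (`|e| * k) * w r + (- `|e|) * `|f r|)).
    have hu := is_derive_dotl hdot e ur.
    exact: is_deriveD hu (is_deriveD (is_deriveZ _ Wr) (is_deriveZ _ Ar)).
  have f_le : dot (f r) e <= `|e| * `|f r| by rewrite mulrC dot_le_norm.
  have th_le : theta r * dot (T (u r) - u r) e <= `|e| * (k * w r).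
    have th0 := theta_ge0 _ (ltW t0r).
    apply: (@le_trans _ _ (theta r * (p r * `|e|))).
      by rewrite ler_wpM2l// dot_le_norm.
    rewrite mulrA mulrC ler_wpM2l// /w mulrCA ler_wpM2l// pk//.
  by rewrite dotDl dotZl; lra.
have : 0 <= k * (W t - W s) + (A t - A s).
  by rewrite addr_ge0 ?mulr_ge0// subr_ge0 ?W_nd ?A_nd.
have [->|e0] := eqVneq e 0; first by rewrite normr0.
move=> _ phi_st; have {}e0 : 0 < `|e| by rewrite normr_gt0.
rewrite -(ler_pM2l e0) -expr2 (sqr_norm_dot hdot) {1}/e dotDl dotNl.
by move: phi_st; rewrite /phi; lra.
Qed.

Lemma primitive_f_ge0 t : 0 <= A t.
Proof. by rewrite -lee_fin A_int integral_ge0. Qed.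

Lemma primitive_f_bounded : exists2 A_oo, 0 <= A_oo & forall t, A t <= A_oo.
Proof.
have [_ If] := f_L1.
have mD : @measurable _ lambdaT `[t0, +oo[.
  exact: (measurable_completed _ (measurable_itv _)).
have I_fin := integrable_fin_num mD If.
exists (fine (\int[lambda]_(t in `[t0, +oo[) `|f t|%:E)%E).
  by apply: fine_ge0; apply: integral_ge0.
move=> t; rewrite -lee_fin A_int fineK//; apply: ge0_subset_integral.
- exact: measurable_segment.
- exact: mD.
- by have /integrableP[] := If.
- by move=> r _; rewrite lee_fin.
- by move=> r /=; rewrite !in_itv/= andbT => /andP[].
Qed.

(** With [M] the maximum of [|u - x|] on [[t0, t]] and [g = |u t0 - x| <= M], the energy inequality
    gives [M^2 <= g^2 + 2 M A_oo <= M (g + 2 A_oo)], and [M] cancels. *)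
Lemma distance_bounded {x : H} : Fix T x ->
  exists2 B, 0 <= B & forall t, t0 <= t -> `|u t - x| <= B.
Proof.
move=> Fx; have [A_oo A_oo0 AA] := primitive_f_bounded.
exists (`|u t0 - x| + 2 * A_oo); first by rewrite addr_ge0// mulr_ge0.
move=> t t0t; have [c [t0c ct c_max]] := norm_attains_max u_ac t x t0t.
apply: le_trans (c_max t t0t (lexx t)) _.
have := energy_inequality Fx (normr_ge0 _) (lexx t0) t0c
  (fun r t0r rc => c_max r t0r (le_trans rc ct)).
have := c_max t0 (lexx t0) t0t; have := W_nd _ _ t0c.
have := AA c; have := primitive_f_ge0 t0.
move: `|u t0 - x| `|u c - x| (normr_ge0 (u t0 - x)) (normr_ge0 (u c - x)) => g M g0 M0.
move=> A0 Ac Wc gM H1; rewrite leNgt; apply/negP => gM'.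
have : M * (A c - A t0) <= M * A_oo by rewrite ler_wpM2l//; lra.
have : g * g <= M * g by rewrite ler_wpM2r.
have : M * (g + 2 * A_oo) < M * M by rewrite ltr_pM2l//; lra.
by move: H1; rewrite !expr2 mulrDr; lra.
Qed.

Lemma residual_energy_bounded : exists W_oo, forall t, W t <= W_oo.
Proof.
have [x Fx] := T_fix; have [B B0 uB] := distance_bounded Fx.
have [A_oo A_oo0 AA] := primitive_f_bounded.
exists (W t0 + `|u t0 - x| ^+ 2 + 2 * B * A_oo) => t.
apply: (@le_trans _ _ (W (Num.max t0 t))).
  by apply: W_nd; rewrite le_max lexx orbT.
have t0t : t0 <= Num.max t0 t by rewrite le_max lexx.
have := energy_inequality Fx B0 (lexx t0) t0t (fun r t0r _ => uB r t0r).
have : 2 * B * (A (Num.max t0 t) - A t0) <= 2 * B * A_oo.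
  rewrite ler_wpM2l ?mulr_ge0//; have := primitive_f_ge0 t0.
  by have := AA (Num.max t0 t); lra.
by have := sqr_ge0 `|u (Num.max t0 t) - x|; lra.
Qed.

Lemma residual_energy_integrable : lambda.-integrable `[t0, +oo[ (EFin \o w).
Proof.
have [W_oo WW] := residual_energy_bounded.
have mw : measurable_fun (T := lambdaT) `[t0, +oo[ (EFin \o w).
  exact/measurable_EFinP/measurable_residual_energy.
apply/integrableP; split => //.
apply: (@le_lt_trans _ _ W_oo%:E); last exact: ltry.
have -> : (\int[lambda]_(t in `[t0, +oo[) `|(EFin \o w) t| =
    \int[lambda]_(t in `[t0, +oo[) (w t)%:E)%E.
  apply: eq_integral => t; rewrite inE/= in_itv/= andbT => t0t.
  by rewrite ger0_norm// residual_energy_ge0.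
pose F n : set R := `[t0, n%:R]%classic.
have Fnd : nondecreasing_seq F.
  by move=> m n mn; rewrite subsetEset; apply: subset_itvl; rewrite bnd_simp ler_nat.
have mF n : @measurable _ lambdaT (F n) by exact: measurable_segment.
have mwF n : measurable_fun (T := lambdaT) (F n) (EFin \o w).
  apply: measurable_funS mw; first exact: (measurable_completed _ (measurable_itv _)).
  by move=> t; rewrite /F /= !in_itv/= andbT => /andP[].
have wF n t : F n t -> (0 <= (EFin \o w) t)%E.
  by rewrite /F /= in_itv/= => /andP[t0t _]; rewrite lee_fin residual_energy_ge0.
have := ge0_nondecreasing_set_cvg_integral (mu := lambda) Fnd mF mwF wF.
rewrite half_line_bigcup => /cvge_to_le; apply.
by apply: nearW => n; rewrite -W_int lee_fin.
Qed.

(* While [p >= e / 2], [theta * p] is dominated by a multiple of [w], so after a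
   late time [s] with [p s >= e] the solution never leaves a small ball around
   [u s]; then [p >= e / 2] for ever, and [w] is not integrable. *)
Lemma residual_cvg0 : unif_continuous T -> 0 < inf [set theta t | t in `[t0, +oo[] ->
  p t @[t --> +oo] --> (0 : R).
Proof.
move=> /unif_continuousP Tuc; set c := inf _ => c0.
have thc t : t0 <= t -> c <= theta t.
  move=> t0t; apply: ge_inf; last by exists t => //=; rewrite in_itv/= t0t.
  by exists 0 => _ [r /= + <-]; rewrite in_itv/= andbT => /theta_ge0.
apply/cvgrPdist_lt => e e0.
have e40 : 0 < e / 4 by rewrite divr_gt0.
have [d' d'0 Td'] := Tuc _ e40.
(* Within distance [d] of [u s], both [u] and [T u] change by less than [e / 4], so [p] loses at
   most [e / 2]. *)
pose d := Num.min d' (e / 4).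
have d0 : 0 < d by rewrite lt_min d'0.
have p_near s r : e <= p s -> `|u r - u s| < d -> e / 2 <= p r.
  rewrite lt_min => ps /andP[/[dup] rs1 + rs2].
  rewrite distrC => srd'; have := Td' (u s, u r); rewrite -!ball_normE/= => /(_ srd') T_sr.
  have E : T (u s) - u s = (T (u s) - T (u r)) + (T (u r) - u r) + (u r - u s).
    by rewrite !addrA !subrK.
  have := ler_normD ((T (u s) - T (u r)) + (T (u r) - u r)) (u r - u s).
  have := ler_normD (T (u s) - T (u r)) (T (u r) - u r).
  by rewrite -E; move: ps; rewrite /p; lra.
have [W_oo WW] := residual_energy_bounded; have [A_oo _ AA] := primitive_f_bounded.
pose k := 2 / e; have k0 : 0 < k by rewrite divr_gt0.
have FA_nd : {homo (fun t => k * W t + A t) : s t / s <= t}.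
  by move=> s t st; rewrite lerD ?A_nd// ler_wpM2l ?W_nd// ltW.
have FA_le t : k * W t + A t <= k * W_oo + A_oo.
  by rewrite lerD// ler_wpM2l// ltW.
have [S FS] := nondecreasing_bounded_increment FA_nd FA_le d0.
apply: filterS2 (nbhs_pinfty_ge (num_real S)) (nbhs_pinfty_ge (num_real t0)) => s Ss t0s.
rewrite sub0r normrN normr_id ltNge; apply/negP => ps.
have stay t : s <= t -> `|u t - u s| < d.
  move=> st; rewrite ltNge; apply/negP => ut.
  pose Z := [set t | s <= t /\ d <= `|u t - u s|].
  have hZ : has_inf Z by split; [exists t|exists s => r []].
  (* The first time at distance [d] from [u s]: by continuity the distance is at least [d] at [tau],
     whereas [increment_inequality] on [[s, tau]] keeps it below [d]. *)
  pose tau := inf Z.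
  have stau : s <= tau by apply: lb_le_inf; [exists t|move=> r []].
  have before r : s <= r -> r < tau -> `|u r - u s| < d.
    move=> sr rtau; rewrite ltNge; apply/negP => ur.
    by move: rtau; rewrite ltNge ge_inf//; case: hZ.
  have tauZ : d <= `|u tau - u s|.
    rewrite leNgt; apply/negP => utau.
    have dtau : 0 < d - `|u tau - u s| by rewrite subr_gt0.
    have /cvgrPdist_lt/(_ _ dtau)/nbhs_ballP[rho /= rho0 Hrho] :=
      continuous_stopped u_ac tau.
    have [z [sz uz] ztau] := inf_adherent rho0 hZ.
    have tauz : tau <= z by apply: ge_inf; case: hZ.
    have := Hrho z; rewrite /ball/= distrC ger0_norm ?subr_ge0//.
    rewrite !max_r ?(le_trans t0s)// => Hz; have {}Hz := Hz ltac:(lra).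
    have := lerB_dist (u z - u s) (u tau - u s).
    by rewrite opprB addrA subrK (distrC (u z) (u tau)); lra.
  have := @increment_inequality k s tau (ltW k0) t0s stau _.
  have := FS s tau Ss; move=> h1 h2.
  have : `|u tau - u s| < d.
    apply: le_lt_trans (h2 _) _; last by move: h1; lra.
    move=> r sr rtau; have pr := p_near s r ps (before r (ltW sr) rtau).
    by rewrite /k expr2 mulrA ler_peMl ?normr_ge0// mulrAC ler_pdivlMr// mul1r; lra.
  by rewrite ltNge tauZ.
(* A lower bound for [w] after [s], from [theta >= c] and [p >= e / 2]; it forces [W] to grow at
   least linearly. *)
pose kappa := c * (e / 2) ^+ 2.
have kappa0 : 0 < kappa by rewrite mulr_gt0 ?exprn_gt0// divr_gt0.
have W_lin t : s <= t -> kappa * (t - s) <= W t - W s.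
  move=> st; pose phi r := kappa * r + (- 1) * W r.
  suff : phi t <= phi s by rewrite /phi; lra.
  apply: (absolutely_continuous_nonincreasing st).
    apply: absolutely_continuousD.
      exact: absolutely_continuousZ (absolutely_continuous_id s t).
    apply: absolutely_continuousZ.
    exact: absolutely_continuous_sub t0s (lexx t) (W_ac t).
  have FF := ae_filter_ringOfSetsType lambda.
  apply: filterS ae_derivatives => r Hr sr rt.
  have t0r := le_lt_trans t0s sr; have [_ Wr _] := Hr t0r.
  exists (kappa * 1 + (- 1) * w r).
    exact: is_deriveD (is_deriveZ kappa (is_derive_id r 1)) (is_deriveZ (- 1) Wr).
  rewrite mulr1 mulN1r subr_le0 /kappa /w ler_pM ?sqr_ge0 ?thc ?(ltW c0) ?(ltW t0r)//.
  rewrite lerXn2r ?nnegrE ?normr_ge0 ?divr_ge0 ?(ltW e0)//.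
  by apply: p_near ps _; apply: stay; exact: ltW.
(* At this time the linear lower bound for [W] equals [W_oo + 1]. *)
have st : s <= s + (W_oo - W s + 1) / kappa.
  by rewrite lerDl divr_ge0 ?(ltW kappa0)// addr_ge0// subr_ge0.
have := W_lin _ st; rewrite addrAC subrr add0r mulrC divfK ?gt_eqF//.
by have := WW (s + (W_oo - W s + 1) / kappa); lra.
Qed.

(** By the energy inequality [2 B A - |u - x|^2] is nondecreasing after [t0]. Both it and [A] are
    monotone and bounded above, so the squared distance is a difference of convergent functions. *)
Lemma sqr_distance_cvg {x : H} : Fix T x -> cvg (`|u t - x| ^+ 2 @[t --> +oo]).
Proof.
move=> Fx; have [B B0 uB] := distance_bounded Fx.
have [A_oo A_oo0 AA] := primitive_f_bounded.
pose G t := 2 * B * A (Num.max t0 t) - `|u (Num.max t0 t) - x| ^+ 2.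
have G_nd : nondecreasing_fun G.
  move=> s t st; rewrite /G.
  have t0s : t0 <= Num.max t0 s by rewrite le_max lexx.
  have {}st : Num.max t0 s <= Num.max t0 t by rewrite ge_max !le_max lexx st orbT.
  have := energy_inequality Fx B0 t0s st (fun r sr _ => uB r (le_trans t0s sr)).
  by have := W_nd _ _ st; lra.
have G_le : has_ubound (range G).
  exists (2 * B * A_oo) => _ [t _ <-]; rewrite /G.
  have := sqr_ge0 `|u (Num.max t0 t) - x|.
  have : 2 * B * A (Num.max t0 t) <= 2 * B * A_oo by rewrite ler_wpM2l// mulr_ge0.
  lra.
have A_le : has_ubound (range A) by exists A_oo => _ [t _ <-].
have Gl := nondecreasing_cvgr G_nd G_le; have Al := nondecreasing_cvgr A_nd A_le.
apply/cvg_ex; exists (2 * B * sup (range A) - sup (range G)).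
have BAl : 2 * B * A t @[t --> +oo] --> 2 * B * sup (range A) by apply: cvgMr.
apply/cvgrPdist_le => e e0.
have BAGl : 2 * B * A t - G t @[t --> +oo] --> 2 * B * sup (range A) - sup (range G).
  exact: cvgB.
have /cvgrPdist_le/(_ _ e0) := BAGl.
apply: filterS2 (nbhs_pinfty_ge (num_real t0)) => t t0t.
by have <- : 2 * B * A t - G t = `|u t - x| ^+ 2 by rewrite /G max_r//; ring.
Qed.

Lemma weak_convergence : p t @[t --> +oo] --> (0 : R) ->
  demiclosedness_principle dot T ->
  exists2 uhat : H, Fix T uhat & weak_cvg dot +oo u uhat.
Proof.
move=> p0 Tdemi; have [x Fx] := T_fix; have [B B0 uB] := distance_bounded Fx.
apply: (@opial _ _ _ hdot (Fix T) u t0 (B + `|x|)).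
- move=> t t0t; rewrite -[u t](subrK x) (le_trans (ler_normD _ _))// lerD2r.
  exact: uB.
- by move=> y Fy; exact: sqr_distance_cvg.
- move=> t_ y t_oo uy; apply: (Tdemi (u \o t_)) => //.
  exact: (cvg_comp _ _ t_oo p0).
Qed.

End evolution.

Theorem theorem3p1 (R : realType) (H : completeNormedModType R)
    (dot : {dot H for idfun}) (hdot : norm_from_dot dot)
    (t0 : R) (ht0 : 0 < t0)
    (theta : R -> R) (theta_ge0 : forall t, t0 <= t -> 0 <= theta t)
    (theta_loc : locally_integrable_on `[t0, +oo[ theta)
    (f : R -> H) (f_L1 : Bochner_integrable (lebesgue R) `[t0, +oo[ f)
    (T : H -> H) (T_qne : quasi_nonexpansive T) (T_fix : Fix T !=set0)
    (u0 : H) (u : R -> H)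
    (u_sol : strong_global_solution t0 theta f T u0 u) :
  [/\ (lebesgue R).-integrable `[t0, +oo[
        (fun s => (theta s * `|T (u s) - u s| ^+ 2)%:E),
      unif_continuous T -> 0 < inf [set theta t | t in `[t0, +oo[] ->
        `|T (u t) - u t| @[t --> +oo] --> (0 : R) &
      `|T (u t) - u t| @[t --> +oo] --> (0 : R) ->
        demiclosedness_principle dot T ->
        exists2 uhat : H, Fix T uhat & weak_cvg dot +oo u uhat].
Proof.
have [u_ac u_derive _] := u_sol.
have [W [W_int W_nd W_ac W_derive]] := locally_integrable_primitive
  (fun t t0t => residual_energy_ge0 theta_ge0 t t0t)
  (integrable_residual_energy theta_ge0 theta_loc f_L1 T_qne T_fix u_ac u_derive).
have [A [A_int A_nd A_ac A_derive]] := locally_integrable_primitive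
  (fun t _ => normr_ge0 (f t)) (integrable_norm_f f_L1).
split.
- exact: (residual_energy_integrable hdot theta_ge0 theta_loc f_L1 T_qne T_fix u_ac
    u_derive W_int W_nd W_ac W_derive A_int A_ac A_derive).
- exact: (residual_cvg0 hdot theta_ge0 f_L1 T_qne T_fix u_ac
    u_derive W_nd W_ac W_derive A_int A_nd A_ac A_derive).
- exact: (weak_convergence hdot theta_ge0 f_L1 T_qne T_fix u_ac
    u_derive W_nd W_ac W_derive A_int A_nd A_ac A_derive).
Qed.
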